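(* Let $(\zeta_n)_{n\in\mathbb Z}$ be a stationary reversible Markov chain with values in a measurable space $(E,\mathcal E)$, with marginal distribution $\pi$. Let $p\ge4$ be an even integer and let $f:E\to\mathbb R$ be a measurable function with $\int_E|f|^p\,d\pi<\infty$ and $\int_Ef\,d\pi=0$. Let $S_n(f)=\sum_{i=1}^nf(\zeta_i)$. Then there is a constant $C_p$ depending only on $p$ such that for every positive integer $n$, $$ \mathbf E\Bigl(\max_{1\le k\le n}|S_k(f)|^p\Bigr)\le C_p\Biggl[n\,\mathbf E(|f(\zeta_1)|^p)+n\Biggl(\sum_{k=1}^n\frac{1}{k^{1+1/p}}\|\mathbf E_0(S_k(f))\|_p\Biggr)^p $$ $$ +\,n\Biggl(\sum_{k=1}^n\frac{1}{k^{1+2/p}}\|\mathbf E_0(S_k^2(f))-\mathbf E(S_k^2(f))\|_{p/2}\Biggr)^{p/2}+n\Biggl(\sum_{k=1}^n\frac{1}{k^{1+2/p}}\mathbf E(S_k^2(f))\Biggr)^{p/2}\Biggr]. $$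
   Context: Let $Q$ be the transition kernel, $Q(\zeta_0,A)=\mathbf P(\zeta_1\in A\mid\zeta_0)$, also viewed as the operator $(Qf)(\zeta)=\int_Ef(s)Q(\zeta,ds)$. The chain is reversible if $Q=Q^*$, where $Q^*$ is the adjoint of $Q$ (in $\mathbf L^2(\pi)$). $\mathcal F_k=\sigma(\zeta_i,i\le k)$, $\mathbf E_0(Y)=\mathbf E(Y\mid\mathcal F_0)$, $S_k^2(f)=(S_k(f))^2$, and $\|\cdot\|_p$ is the norm in $\mathbf L^p$. The constant $C_p$ does not depend on $n$, the chain or $f$. *)

(* Defs.v *)
From HB Require Import structures.
From mathcomp Require Import all_boot all_order all_algebra.
From mathcomp Require Import all_classical all_reals all_analysis.
From mathcomp Require Import measurable_realfun.

Set Implicit Arguments.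
Unset Strict Implicit.
Unset Printing Implicit Defensive.

Import Order.TTheory GRing.Theory Num.Theory.
Import numFieldNormedType.Exports.

Local Open Scope classical_set_scope.
Local Open Scope ring_scope.

Section conditional_expectation.
Context d (T : measurableType d) (R : realType) (P : probability T R).
Implicit Types (G : set (set T)) (X Y : T -> R).

Definition is_condexp G X Y : Prop :=
  [/\ forall B : set R, measurable B -> G (Y @^-1` B),
      P.-integrable setT (EFin \o Y) &
      forall A, G A -> (\int[P]_(w in A) (Y w)%:E = \int[P]_(w in A) (X w)%:E)%E].

(* An arbitrary version of E(X | G); [condexpP] shows that the default value
   is never used when G is a sub-sigma-algebra and X is integrable. *)
Definition condexp G X : T -> R := xget (cst 0) [set Y | is_condexp G X Y].

End conditional_expectation.

Section condexp_exists.
Context d (T : measurableType d) (R : realType) (P : probability T R).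
Variables (G : set (set T)) (sG : sigma_algebra setT G)
  (Gm : G `<=` measurable).

Let TG : measurableType G.-sigma := g_sigma_algebraType G.

Let measurable_idTG : measurable_fun setT (idfun : T -> TG).
Proof.
move=> _ A mA; rewrite setTI; apply: Gm.
by move: mA; rewrite measurable_g_measurableTypeE.
Qed.

Let idTG : {mfun T >-> TG} :=
  MeasurableFun.Pack (MeasurableFun.Class
    (isMeasurableFun.Build _ _ T TG (idfun : T -> TG) measurable_idTG)).

Lemma condexpP (X : T -> R) : P.-integrable setT (EFin \o X) ->
  is_condexp P G X (condexp P G X).
Proof.
move=> iX; suff [Y XY] : exists Y, is_condexp P G X Y.
  by rewrite /condexp; case: xgetP => [Z -> //|/(_ Y)].
pose nu0 := induced_charge iX.
have nu0P : nu0 `<< P.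
  apply/null_content_dominatesP => A mA PA0.
  apply: null_set_integral => //.
  have /integrableP[mX _] := iX; exact: measurable_funS mX.
pose nuG : set TG -> \bar R := nu0.
have mTG (A : set TG) : measurable A -> measurable (A : set T).
  by rewrite measurable_g_measurableTypeE//; exact: Gm.
have snuG : semi_sigma_additive nuG.
  move=> F mF tF mUF; apply: (@charge_semi_sigma_additive _ _ _ nu0) => //.
  - by move=> n; exact: mTG.
  - exact: mTG.
pose nu : {charge set TG -> \bar R} :=
  HB.pack nuG (isCharge.Build _ _ _ nuG (charge0 nu0)
    (fun A mA => fin_num_measure nu0 A (mTG A mA)) snuG).
pose PG := distribution P idTG.
have nuPG : nu `<< PG := dominates_pushforward measurable_idTG nu0P.
pose g := Radon_Nikodym nu PG.
have ig : PG.-integrable setT g by exact: Radon_Nikodym_integrable.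
have mg : measurable_fun (setT : set TG) (g : TG -> \bar R) by exact: measurable_int ig.
have gfin x : g x \is a fin_num by exact: Radon_Nikodym_fin_num.
have igP : P.-integrable setT (g \o idTG).
  apply/integrableP; split; first exact: measurableT_comp.
  have /integrableP[_] := ig.
  rewrite ge0_integral_pushforward//; exact: measurableT_comp.
have gE : EFin \o (fine \o g) = g.
  by apply/funext => x /=; rewrite fineK.
exists (fine \o g); split.
- move=> B mB.
  have mfg : measurable_fun (setT : set TG) (fine \o g).
    exact: measurableT_comp.
  have := mfg measurableT B mB.
  by rewrite setTI measurable_g_measurableTypeE.
- by rewrite gE.
- move=> A GA.
  have mA : measurable (A : set TG).
    by rewrite measurable_g_measurableTypeE.
  transitivity (nu A); last by [].
  rewrite (Radon_Nikodym_integral nuPG mA) integral_pushforward//.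
    by apply: eq_integral => x _ /=; rewrite fineK.
  by apply: integrableS igP => //; exact: Gm.
Qed.
End condexp_exists.

Section chain.
Context d dE (T : measurableType d) (E : measurableType dE) (R : realType)
  (P : probability T R).
Implicit Types (zeta : int -> {RV P >-> E}) (Q : R.-pker E ~> E)
  (f g h : E -> R).

Definition past zeta (k : int) : set (set T) :=
  <<s \bigcup_(i in [set i : int | i <= k]) g_sigma_algebra_preimage (zeta i) >>.

(* Invariance under shifts of the finite-dimensional distributions, tested on
   measurable rectangles. *)
Definition stationary zeta : Prop :=
  forall (m : int) (s : seq int) (A : int -> set E),
    (forall i, measurable (A i)) ->
    P (\bigcap_(i in [set` s]) zeta (i + m) @^-1` A i) =
    P (\bigcap_(i in [set` s]) zeta i @^-1` A i).

Definition markov_property zeta : Prop :=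
  forall (n : int) (A : set E), measurable A ->
    condexp P (past zeta n) \1_(zeta (n + 1) @^-1` A) =
    condexp P (g_sigma_algebra_preimage (zeta n)) \1_(zeta (n + 1) @^-1` A)
      %[ae P].

Definition transition_kernel zeta Q : Prop :=
  forall A : set E, measurable A ->
    condexp P (g_sigma_algebra_preimage (zeta 0)) \1_(zeta 1 @^-1` A) =
    (fun w => fine (Q (zeta 0 w) A)) %[ae P].

Definition kernel_op Q f : E -> R := fun x => (\int[Q x]_s f s)%R.

Definition adjoint_L2 (pi : probability E R) (U V : (E -> R) -> E -> R) : Prop :=
  forall g h, g \in Lfun pi 2%:E -> h \in Lfun pi 2%:E ->
    (\int[pi]_x (U g x * h x) = \int[pi]_x (g x * V h x))%R.

Definition reversible (pi : probability E R) Q : Prop :=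
  adjoint_L2 pi (kernel_op Q) (kernel_op Q).

Definition partial_sum zeta f (n : nat) : T -> R :=
  fun w => \sum_(1 <= i < n.+1) f (zeta i%:Z w).

End chain.

(* Main.v *)
(* For p even, expand (S_j + S'_j)^p with S'_j = S_{2j} - S_j.  The mixed terms
   of degree between 2 and p - 2 are dominated by S_j^2 S'_j^(p-2) and
   S_j^(p-2) S'_j^2, and reversibility turns the terms in which S'_j carries the
   high power into those in which S_j does; conditioning these on the past of
   time j gives
     E S_{2j}^p <= 2 E S_j^p + 2 p ||S_j||_p^(p-1) ||E_0 S_j||_p
                   + c ||S_j||_p^(p-2) ||E_0 S_j^2||_{p/2},
   a recursion along j = 2^r that involves no power of the conditional norms.
   Both conditional norms are quasi-subadditive in j, so their dyadic sums are
   controlled by the full sums with weights k^(-1-1/p) and k^(-1-2/p).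

   For the maximum, round k up to successive multiples k_l of 2^l and write
   S_k = S_{2^N} - sum_l (S_{k_{l+1}} - S_{k_l}), each increment being replaced by
   its conditional expectation given the past of k_l.  Tested against functions
   of the past of k, this is a Doob inequality with |S_{2^N}| and, for each l, the
   maximum of 2^(N-l) conditional expectations on the right-hand side. *)
Require Import Defs.
From HB Require Import structures.
From mathcomp Require Import all_boot all_order all_algebra.
From mathcomp Require Import all_classical all_reals all_analysis.
From mathcomp Require Import measurable_realfun.
From mathcomp Require Import ring lra zify.

Set Implicit Arguments.
Unset Strict Implicit.
Unset Printing Implicit Defensive.

Import Order.TTheory GRing.Theory Num.Theory.
Import numFieldNormedType.Exports.

Local Open Scope ring_scope.

(** Dividing the recursion by 2^(r+1) turns its leading coefficient 2 into 1: A_r = ||S_{2^r}||_p /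
    2^(r/p) satisfies A_{r+1}^p <= A_r^p plus terms of degree p-1 and p-2 in A_r. Evaluated at the
    index up to N where A is largest, this becomes one polynomial inequality in which the
    conditional norms are summed before any power is taken; hence the sums inside the powers p and
    p/2 of the bound. A maximum of 2^(N-l) variables costs 2^((N-l)/p) in L^p, so the maximal part
    leads to the same normalised sum. The last two terms of the bound come from splitting ||E_0
    S_k^2||_{p/2} into a centred norm and a mean. Two obstacles shape the rest. Norms of conditional
    expectations at different times must be compared although versions are arbitrary, so
    conditioning takes place on the space of paths. Reversibility is a statement about the kernel,
    while the recursion needs it for joint moments of two adjacent blocks, so it is carried over to
    cylinder events and then to the law of the whole path. *)

(** * Elementary inequalities and the real recursion *)

Lemma young_pow (R : realDomainType) m (a b : R) : 0 <= a -> 0 <= b ->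
  m.+1%:R * (a * b ^+ m) <= a ^+ m.+1 + m%:R * b ^+ m.+1.
Proof.
move=> a0 b0; elim: m => [|m IH]; first by rewrite mul0r addr0 !expr0 expr1 mulr1 mul1r.
(* The two factors have the same sign; added to the induction hypothesis times [b], this is the
   claim. *)
have H : 0 <= (a - b) * (a ^+ m.+1 - b ^+ m.+1).
  have [ab|ba] := leP b a.
    by rewrite mulr_ge0 ?subr_ge0// lerXn2r ?nnegrE.
  by rewrite mulr_le0 ?subr_le0 ?(ltW ba)// lerXn2r ?nnegrE ?(ltW ba).
have {}IH := ler_wpM2r b0 IH.
move: IH H; rewrite !exprS -!natr1.
set u := a ^+ m; set v := b ^+ m; set k := m%:R; clearbody u v k; lra.
Qed.

(** Young's inequality gives the factor (m+2)/(m+1), rounded up to 2. With [b] and [a] the old and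
    new values of a running maximum, this is the increment on which Doob's inequality rests. *)
Lemma expr_increment_le (R : realFieldType) m (a b : R) : 0 <= b -> b <= a ->
  a ^+ m.+2 - b ^+ m.+2 <= 2 * (a * (a ^+ m.+1 - b ^+ m.+1)).
Proof.
move=> b0 ba; have a0 := le_trans b0 ba.
have H := young_pow m.+1 a0 b0.
have H2 : b ^+ m.+1 <= a ^+ m.+1 by rewrite lerXn2r ?nnegrE.
have H3 : 0 <= m%:R * (a * (a ^+ m.+1 - b ^+ m.+1)) by rewrite !mulr_ge0 ?subr_ge0.
rewrite -(@ler_pM2l _ m.+1%:R)//.
move: H H3; rewrite (exprS a m.+1) -!natr1.
move: (a ^+ m.+1) (b ^+ m.+1) (b ^+ m.+2) m%:R => u v w k; nra.
Qed.

Lemma expr_mix_le (R : realDomainType) i j (x y : R) : 0 <= x -> 0 <= y ->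
  x ^+ i * y ^+ j <= x ^+ (i + j) + y ^+ (i + j).
Proof.
move=> x0 y0; have [xy|/ltW yx] := leP x y.
  apply: (@le_trans _ _ (y ^+ (i + j))); last by rewrite lerDr exprn_ge0.
  by rewrite exprD ler_wpM2r ?exprn_ge0// lerXn2r ?nnegrE.
apply: (@le_trans _ _ (x ^+ (i + j))); last by rewrite lerDl exprn_ge0.
by rewrite exprD ler_wpM2l ?exprn_ge0// lerXn2r ?nnegrE.
Qed.

(** The two terms linear in [x] or [y] stay exact, because their expectations are bounded by
    conditioning, which needs their signs. Every other mixed term is x^2 y^2 times a monomial of
    even degree [q], dominated by x^q + y^q; [2 ^+ q.+4] bounds the sum of the binomial coefficients
    involved. *)
Lemma exprD_even_le (R : realDomainType) q (x y : R) : ~~ odd q ->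
  (x + y) ^+ q.+4 <= x ^+ q.+4 + y ^+ q.+4
    + q.+4%:R * (x ^+ q.+3 * y) + q.+4%:R * (x * y ^+ q.+3)
    + 2 ^+ q.+4 * (x ^+ q.+2 * y ^+ 2 + x ^+ 2 * y ^+ q.+2).
Proof.
move=> oq; set z := _ + _ * y ^+ q.+2.
have z0 : 0 <= z.
  by apply: addr_ge0; apply: mulr_ge0; rewrite real_exprn_even_ge0 ?num_real//= ?negbK.
rewrite exprDn big_ord_recl big_ord_recr big_ord_recl big_ord_recr /=.
rewrite /bump /= bin0 bin1 binn binSn subn0 subn1 subnn /=.
rewrite (_ : q.+4 - q.+3 = 1)%N; last by lia.
rewrite !expr0 !expr1 !mulr1 !mul1r !mulr1n /=.
set mid := bigop.body _ _ _.
suff : mid <= 2 ^+ q.+4 * z.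
  rewrite !mulr_natl; move: mid (2 ^+ _ * z) => u v.
  move: (x ^+ q.+4) (y ^+ q.+4) (x ^+ q.+3 * y *+ _) (x * y ^+ q.+3 *+ _).
  move=> a b c e; lra.
apply: (@le_trans _ _ (\sum_(i < q.+1) z *+ 'C(q.+4, i.+2))).
  apply: ler_sum => i _; rewrite /bump /= !add1n; apply: ler_wMn2r.
  have -> : (q.+4 - i.+2 = (q - i) + 2)%N by have := ltn_ord i; lia.
  have -> : (i.+2 = i + 2)%N by rewrite addn2.
  rewrite !exprD /z -(addn2 q) !exprD.
  have -> : x ^+ (q - i) * x ^+ 2 * (y ^+ i * y ^+ 2)
    = (x ^+ (q - i) * y ^+ i) * (x ^+ 2 * y ^+ 2) by ring.
  have -> : x ^+ q * x ^+ 2 * y ^+ 2 + x ^+ 2 * (y ^+ q * y ^+ 2) =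
    (x ^+ q + y ^+ q) * (x ^+ 2 * y ^+ 2) by ring.
  apply: ler_wpM2r; first by rewrite mulr_ge0 ?sqr_ge0.
  apply: le_trans (ler_norm _) _; rewrite normrM !normrX.
  have := @expr_mix_le _ (q - i) i _ _ (normr_ge0 x) (normr_ge0 y).
  have -> : (q - i + i = q)%N by rewrite subnK// -ltnS.
  by rewrite -!normrX (ger0_norm (_ : 0 <= x ^+ q)) ?(ger0_norm (_ : 0 <= y ^+ q))// real_exprn_even_ge0 ?num_real.
rewrite sumrMnr -[X in X <= _]mulr_natl; apply: ler_wpM2r => //.
rewrite -natrX ler_nat -[2%N]/(1 + 1)%N expnDn; set S := (X in (X <= _)%N).
under eq_bigr do rewrite !exp1n !muln1.
rewrite big_ord_recl big_ord_recr big_ord_recl big_ord_recr /=.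
apply: (leq_trans _ (leq_addl _ _)); apply: (leq_trans _ (leq_addr _ _)).
by apply: (leq_trans _ (leq_addl _ _)); exact: leq_addr.
Qed.

(** One of the three terms on the right is at least a third of [b ^+ q.*2.+2]; solving that case for
    [b] gives the corresponding summand. *)
Lemma root_split (R : realFieldType) q (b al U W : R) :
  0 <= b -> 0 <= al -> 0 <= U -> 0 <= W ->
  b ^+ q.*2.+2 <= al + b ^+ q.*2.+1 * U + b ^+ q.*2 * W ->
  b ^+ q.*2.+2 <= 3 * al + (3 * U) ^+ q.*2.+2 + (3 * W) ^+ q.+1.
Proof.
move=> b0 al0 U0 W0 H.
have e1 : 0 <= (3 * U) ^+ q.*2.+2 by rewrite exprn_ge0 ?mulr_ge0.
have e2 : 0 <= (3 * W) ^+ q.+1 by rewrite exprn_ge0 ?mulr_ge0.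
have [h|h1] := leP (b ^+ q.*2.+2) (3 * al); first lra.
have [h|h2] := leP (b) (3 * U).
  have : b ^+ q.*2.+2 <= (3 * U) ^+ q.*2.+2 by rewrite lerXn2r ?nnegrE ?mulr_ge0.
  lra.
have [h|h3] := leP (b ^+ 2) (3 * W).
  have : b ^+ q.*2.+2 <= (3 * W) ^+ q.+1.
    by rewrite -doubleS -mul2n exprM lerXn2r ?nnegrE ?mulr_ge0 ?exprn_ge0.
  lra.
have bp : 0 < b by apply: le_lt_trans h2; rewrite mulr_ge0.
have bq := exprn_gt0 q.*2 bp.
exfalso; move: H h1 h3; rewrite !exprS expr0 mulr1.
have : b ^+ q.*2 * (b * (3 * U)) < b ^+ q.*2 * (b * b) by rewrite !ltr_pM2l.
move=> h4 h5 h6 h7.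
have : b ^+ q.*2 * (3 * W) < b ^+ q.*2 * (b * b) by rewrite ltr_pM2l.
move: h4 h5 h6; move: (b ^+ _) => X; lra.
Qed.

(** Unrolling the recursion up to the index [s] at which [A] is largest, and bounding each power of
    [A] by that of [A s], leaves for [A s] alone an inequality of the form of [root_split]. *)
Lemma recursion_bound (R : realFieldType) q (A U W : nat -> R) (c1 c2 : R) N :
  (forall r, 0 <= A r) -> (forall r, 0 <= U r) -> (forall r, 0 <= W r) ->
  0 <= c1 -> 0 <= c2 ->
  (forall r, (r < N)%N -> A r.+1 ^+ q.*2.+2 <=
     A r ^+ q.*2.+2 + c1 * (A r ^+ q.*2.+1 * U r) + c2 * (A r ^+ q.*2 * W r)) ->
  A N ^+ q.*2.+2 <= 3 * A 0 ^+ q.*2.+2 + (3 * (c1 * \sum_(r < N) U r)) ^+ q.*2.+2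
    + (3 * (c2 * \sum_(r < N) W r)) ^+ q.+1.
Proof.
move=> A0 U0 W0 c10 c20 H.
have [s sN sM] : exists2 s, (s <= N)%N & forall r, (r <= N)%N -> A r <= A s.
  elim: {H} N => [|N [s sN IH]]; first by exists 0%N => // r; rewrite leqn0 => /eqP ->.
  have [h|h] := leP (A N.+1) (A s).
    by exists s => [|r]; [exact: leqW|rewrite leq_eqVlt => /predU1P[->//|/IH]].
  exists N.+1 => // r; rewrite leq_eqVlt => /predU1P[->//|/IH rs].
  exact: le_trans rs (ltW h).
have mono (F : nat -> R) t : (forall r, 0 <= F r) -> (t <= N)%N ->
    \sum_(r < t) F r <= \sum_(r < N) F r.
  move=> F0 tN; rewrite -!(big_mkord xpredT F) (big_cat_nat (n:=t) (p:=N))//= lerDl.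
  by apply: sumr_ge0.
have K t : (t <= N)%N -> A t ^+ q.*2.+2 <= A 0 ^+ q.*2.+2 +
    A s ^+ q.*2.+1 * (c1 * \sum_(r < t) U r) + A s ^+ q.*2 * (c2 * \sum_(r < t) W r).
  elim: t => [|t IH] tN; first by rewrite !big_ord0 !mulr0 !addr0.
  apply: (le_trans (H _ tN)); rewrite !big_ord_recr/= !mulrDr.
  have := IH (ltnW tN).
  have : c1 * (A t ^+ q.*2.+1 * U t) <= A s ^+ q.*2.+1 * (c1 * U t).
    by rewrite mulrCA ler_wpM2r ?mulr_ge0// lerXn2r ?nnegrE// sM// ltnW.
  have : c2 * (A t ^+ q.*2 * W t) <= A s ^+ q.*2 * (c2 * W t).
    by rewrite mulrCA ler_wpM2r ?mulr_ge0// lerXn2r ?nnegrE// sM// ltnW.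
  lra.
apply: (@le_trans _ _ (A s ^+ q.*2.+2)); first by rewrite lerXn2r ?nnegrE ?sM.
apply: root_split; [exact: A0|exact: exprn_ge0|by rewrite mulr_ge0 ?sumr_ge0..|].
apply: (le_trans (K _ sN)); apply: lerD; first apply: lerD => //.
  by rewrite !ler_wpM2l ?exprn_ge0// mono.
by rewrite !ler_wpM2l ?exprn_ge0// mono.
Qed.

(** * Dyadic sums of quasi-subadditive sequences *)

Section dyadic.
Variables (R : realType) (V : nat -> R) (c g : R).
Hypotheses (V0 : forall k, 0 <= V k) (c0 : 0 <= c) (g0 : 0 <= g).
Hypothesis Vsub : forall i j, (0 < i)%N -> (0 < j)%N -> V (i + j)%N <= c * (V i + V j).

Let weight (k : nat) := (k%:R `^ (1 + g))^-1 : R.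

Let weight_ge0 k : 0 <= weight k.
Proof. by rewrite invr_ge0 powR_ge0. Qed.

Let weight_half r : weight (2 ^ r.+1) <= weight (2 ^ r) / 2.
Proof.
rewrite /weight -invfM lef_pV2 ?posrE ?mulr_gt0 ?powR_gt0 ?ltr0n ?expn_gt0//.
rewrite expnSr natrM powRM ?ler0n// ler_wpM2l ?powR_ge0//.
by rewrite -{1}(powRr1 (ler0n R 2)) ler_powR ?ler1n// lerDl.
Qed.

Let weight_decr i j : (0 < i)%N -> (i <= j)%N -> weight j <= weight i.
Proof.
move=> i0 ij; rewrite /weight lef_pV2 ?posrE ?powR_gt0 ?ltr0n ?(leq_trans i0)//.
by apply: ge0_ler_powR; rewrite ?nnegrE ?ler0n ?ler_nat// addr_ge0.
Qed.

Let F r := weight (2 ^ r) * \sum_(1 <= k < 2 ^ r) V k.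

(** The weight at least halves from 2^r to 2^(r+1), so [F N.+1] is at most half of [F N] plus the
    new dyadic block. Carrying the extra [F N] on the left lets this halving close the induction. *)
Let sum_F N : \sum_(r < N.+1) F r + F N <= 2 * \sum_(1 <= k < 2 ^ N) weight k * V k.
Proof.
elim: N => [|N IH]; first by rewrite big_ord1 /F expn0 !big_geq// !mulr0 addr0.
have le2 : (1 <= 2 ^ N <= 2 ^ N.+1)%N by rewrite expn_gt0/= leq_exp2l.
rewrite big_ord_recr/= (big_cat_nat (n := 2 ^ N))//=; [|by case/andP: le2..].
have : F N.+1 <= F N / 2 + \sum_(2 ^ N <= k < 2 ^ N.+1) weight k * V k.
  rewrite /F (big_cat_nat (n := 2 ^ N))//=; [|by case/andP: le2..].
  rewrite mulrDr; apply: lerD.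
    by rewrite mulrAC ler_wpM2r ?sumr_ge0.
  rewrite mulr_sumr !big_nat; apply: ler_sum => k /andP[k1 k2].
  by rewrite ler_wpM2r// weight_decr ?(ltnW k2)// (leq_trans _ k1)// expn_gt0.
lra.
Qed.

(** Quasi-subadditivity at [m = k + (m - k)], summed over all [k]; each value of [V] occurs
    twice. *)
Let sub_sum m : (0 < m)%N -> m.-1%:R * V m <= 2 * c * \sum_(1 <= k < m) V k.
Proof.
move=> m0.
have -> : m.-1%:R * V m = \sum_(1 <= k < m) V m.
  by rewrite sumr_const_nat mulr_natl subn1.
have -> : 2 * c * \sum_(1 <= k < m) V k = \sum_(1 <= k < m) c * (V k + V (m - k)%N).
  rewrite -mulr_sumr big_split/= [X in _ + X]big_nat_rev/=.
  rewrite [X in _ + X](_ : _ = \sum_(1 <= k < m) V k); first by rewrite -mulrA mulrCA mulrDl !mul1r.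
  by rewrite !big_nat; apply: eq_bigr => k /andP[k1 k2]; congr V; lia.
rewrite !big_nat; apply: ler_sum => k /andP[k1 k2].
by rewrite -{1}(subnKC (ltnW k2)) Vsub// subn_gt0.
Qed.

Lemma dyadic_sum_le N : \sum_(r < N) V (2 ^ r) / (2 ^ r)%:R `^ g <=
  (1 + 8 * c) * \sum_(1 <= k < 2 ^ N) weight k * V k.
Proof.
case: N => [|N]; first by rewrite big_ord0 big_geq ?mulr0.
have term r : (0 < r)%N -> V (2 ^ r) / (2 ^ r)%:R `^ g <= 4 * c * F r.
  move=> r0; have p0 : (0 < (2 ^ r)%:R :> R) by rewrite ltr0n expn_gt0.
  rewrite /F /weight powRD; last by apply/implyP => /eqP h; move: g0; rewrite gt_eqF.
  rewrite powRr1 ?ler0n// invfM; set S := \sum_(_ <= _ < _) _.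
  have -> : 4 * c * ((2 ^ r)%:R^-1 / (2 ^ r)%:R `^ g * S) =
      (4 * c * S / (2 ^ r)%:R) / (2 ^ r)%:R `^ g.
    by move: _^-1 (_ `^ _)^-1 => a b; ring.
  rewrite ler_wpM2r ?invr_ge0 ?powR_ge0// ler_pdivlMr//.
  (* [sub_sum] carries the factor 2^r - 1, at least 2^r / 2 because [r > 0]. The term [r = 0] is
     [V 1], the first term of the weighted sum; it accounts for the 1 in [1 + 8 * c]. *)
  have : (2 ^ r)%:R / 2 * V (2 ^ r) <= 2 * c * S.
    apply: le_trans (sub_sum _); last by rewrite expn_gt0.
    rewrite ler_wpM2r// ler_pdivrMr// -natrM ler_nat.
    have : (1 < 2 ^ r)%N by rewrite -{1}(expn0 2) ltn_exp2l.
    by move: (2 ^ r)%N => x; lia.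
  move: (2 ^ r)%:R => x; nra.
rewrite big_ord_recl/= expn0 powR1 divr1.
have h1 : \sum_(i < N) V (2 ^ bump 0 i) / (2 ^ bump 0 i)%:R `^ g <= 4 * c * \sum_(r < N.+2) F r.
  rewrite [X in _ <= _ * X]big_ord_recl [X in _ <= _ * (_ + X)]big_ord_recr/= mulrDr mulrDr.
  have F0 r : 0 <= F r by rewrite /F mulr_ge0// sumr_ge0.
  have : 0 <= 4 * c * F 0 by apply: mulr_ge0 (F0 _); rewrite mulr_ge0.
  have : 0 <= 4 * c * F (bump 0 N) by apply: mulr_ge0 (F0 _); rewrite mulr_ge0.
  have : \sum_(i < N) V (2 ^ bump 0 i) / (2 ^ bump 0 i)%:R `^ g <=
     4 * c * \sum_(i < N) F (bump 0 i).
    by rewrite mulr_sumr; apply: ler_sum => i _; apply: term.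
  lra.
have h2 := sum_F N.+1.
have h3 : V 1 <= \sum_(1 <= k < 2 ^ N.+1) weight k * V k.
  rewrite big_ltn; last by rewrite -{1}(expn0 2) ltn_exp2l.
  by rewrite {1}/weight powR1 invr1 mul1r lerDl sumr_ge0// => k _; rewrite mulr_ge0.
have F0 : 0 <= F N.+1 by rewrite /F mulr_ge0// sumr_ge0.
have : 4 * c * \sum_(r < N.+2) F r <= 4 * c * (2 * \sum_(1 <= k < 2 ^ N.+1) weight k * V k).
  by rewrite ler_wpM2l ?mulr_ge0//; lra.
lra.
Qed.

End dyadic.

(** * Moments and the maximal inequality *)

Local Open Scope classical_set_scope.

Lemma normD_expr_le (R : realDomainType) m (x y : R) :
  `|x + y| ^+ m <= 2 ^+ m * (`|x| ^+ m + `|y| ^+ m).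
Proof.
wlog xy : x y / `|x| <= `|y|.
  move=> H; have [/H//|/ltW/H] := leP `|x| `|y|.
  by rewrite addrC [X in _ * X]addrC.
apply: (@le_trans _ _ (2 ^+ m * `|y| ^+ m)).
  rewrite -exprMn lerXn2r ?nnegrE ?mulr_ge0//.
  by apply: le_trans (ler_normD _ _) _; lra.
by rewrite ler_wpM2l ?exprn_ge0// lerDr exprn_ge0.
Qed.

Section lp.
Context d (T : measurableType d) (R : realType) (P : probability T R).
Implicit Types X Y : T -> R.
Local Notation Ex X := (Rintegral P setT X).
Local Notation Int X := (P.-integrable setT (EFin \o X)).

Lemma Int_meas X : Int X -> measurable_fun setT X.
Proof. by move/measurable_int/measurable_EFinP. Qed.

Lemma Int_le X Y : measurable_fun setT X -> (forall w, `|X w| <= Y w) ->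
  Int Y -> Int X.
Proof.
move=> mX XY; apply: le_integrable => //; first exact/measurable_EFinP.
by move=> w _; rewrite /= lee_fin (le_trans (XY w))// ler_norm.
Qed.

Lemma IntD X Y : Int X -> Int Y -> Int (fun w => X w + Y w).
Proof. by move=> iX iY; exact: (integrableD measurableT iX iY). Qed.

Lemma IntZ k X : Int X -> Int (fun w => k * X w).
Proof. by move=> iX; exact: (integrableZl measurableT k iX). Qed.

Lemma IntB X Y : Int X -> Int Y -> Int (fun w => X w - Y w).
Proof. by move=> iX iY; exact: (integrableB measurableT iX iY). Qed.

Lemma Int_cst k : Int (cst k).
Proof. exact: finite_measure_integrable_cst. Qed.

Lemma Int_sum I (s : seq I) (p : pred I) (h : I -> T -> R) :
  (forall i, p i -> Int (h i)) -> Int (fun w => \sum_(i <- s | p i) h i w).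
Proof.
move=> hi; have := @integrable_sum _ T R P setT measurableT I s p (fun i => EFin \o h i) hi.
by apply: eq_integrable => // w _; rewrite /= sumEFin.
Qed.

Lemma Int_mulB K X Y : measurable_fun setT Y -> (forall w, `|Y w| <= K) ->
  Int X -> Int (fun w => Y w * X w).
Proof.
move=> mY YK iX; apply: (@Int_le _ (fun w => K * `|X w|)).
- by apply: measurable_funM => //; exact: Int_meas.
- by move=> w; rewrite normrM ler_wpM2r.
- by apply: IntZ; exact: integrable_norm.
Qed.

Lemma Ex_le X Y : Int X -> Int Y -> (forall w, X w <= Y w) -> Ex X <= Ex Y.
Proof. by move=> iX iY XY; apply: le_Rintegral. Qed.

Lemma Ex_ge0 X : (forall w, 0 <= X w) -> 0 <= Ex X.
Proof. by move=> X0; apply: Rintegral_ge0. Qed.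

Lemma ExD X Y : Int X -> Int Y -> Ex (fun w => X w + Y w) = Ex X + Ex Y.
Proof. by move=> iX iY; rewrite RintegralD. Qed.

Lemma ExB X Y : Int X -> Int Y -> Ex (fun w => X w - Y w) = Ex X - Ex Y.
Proof. by move=> iX iY; rewrite RintegralB. Qed.

Lemma ExZ k X : Int X -> Ex (fun w => k * X w) = k * Ex X.
Proof. by move=> iX; rewrite RintegralZl. Qed.

Lemma Ex_sum I (s : seq I) (h : I -> T -> R) :
  (forall i, Int (h i)) -> Ex (fun w => \sum_(i <- s) h i w) = \sum_(i <- s) Ex (h i).
Proof.
move=> hi; elim: s => [|i s IH].
  rewrite big_nil; under eq_Rintegral do rewrite big_nil.
  by rewrite Rintegral_cst// mul0r.
rewrite big_cons -IH -ExD//; last exact: Int_sum.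
by apply: eq_Rintegral => w _; rewrite big_cons.
Qed.

Lemma Ex_EFin X : Int X -> (\int[P]_w (X w)%:E = (Ex X)%:E)%E.
Proof. by move=> iX; rewrite /Rintegral fineK//; exact: integrable_fin_num. Qed.

Definition inL (m : nat) X := measurable_fun setT X /\ Int (fun w => `|X w| ^+ m).

Lemma inL_le m X Y : measurable_fun setT X -> (forall w, `|X w| <= `|Y w|) ->
  inL m Y -> inL m X.
Proof.
move=> mX XY [mY iY]; split => //; apply: Int_le iY.
  by apply: measurable_funX; exact: measurableT_comp.
by move=> w; rewrite normrX normr_id lerXn2r ?nnegrE.
Qed.

Lemma inL_norm m X : inL m X -> inL m (fun w => `|X w|).
Proof.
move=> [mX iX]; split; first exact: measurableT_comp.
by under eq_fun do rewrite normr_id.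
Qed.

Lemma inLD m X Y : inL m X -> inL m Y -> inL m (fun w => X w + Y w).
Proof.
move=> [mX iX] [mY iY]; split; first exact: measurable_funD.
apply: (@Int_le _ (fun w => 2 ^+ m * (`|X w| ^+ m + `|Y w| ^+ m))).
- by apply: measurable_funX; apply: measurableT_comp => //; exact: measurable_funD.
- by move=> w; rewrite normrX normr_id normD_expr_le.
- by apply: IntZ; exact: IntD.
Qed.

Lemma inLN m X : inL m X -> inL m (fun w => - X w).
Proof.
move=> [mX iX]; split; first exact: measurableT_comp.
by under eq_fun do rewrite normrN.
Qed.

Lemma inL_bounded m K X : measurable_fun setT X -> (forall w, `|X w| <= K) -> inL m X.
Proof.
move=> mX XK; split => //; apply: (@Int_le _ (cst (K ^+ m))); last exact: Int_cst.
  by apply: measurable_funX; exact: measurableT_comp.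
by move=> w; rewrite normrX normr_id lerXn2r ?nnegrE// (le_trans _ (XK w)).
Qed.

Lemma inL0 m : inL m (cst 0).
Proof. by apply: (@inL_bounded _ 0) => // w; rewrite normr0. Qed.

Lemma inL_sum m I (s : seq I) (h : I -> T -> R) :
  (forall i, inL m (h i)) -> inL m (fun w => \sum_(i <- s) h i w).
Proof.
move=> hi; elim: s => [|i s IH].
  by under eq_fun do rewrite big_nil; exact: inL0.
by under eq_fun do rewrite big_cons; exact: inLD.
Qed.

Lemma inL_exp m k X : inL (k * m) X -> inL m (fun w => X w ^+ k).
Proof.
move=> [mX iX]; split; first exact: measurable_funX.
by under eq_fun do rewrite normrX -exprM.
Qed.

Lemma inL_mix i j X Y : inL (i + j) X -> inL (i + j) Y ->
  Int (fun w => X w ^+ i * Y w ^+ j).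
Proof.
move=> [mX iX] [mY iY].
apply: (@Int_le _ (fun w => `|X w| ^+ (i + j) + `|Y w| ^+ (i + j))).
- by apply: measurable_funM; exact: measurable_funX.
- by move=> w; rewrite normrM !normrX expr_mix_le.
- exact: IntD.
Qed.

Lemma inL_Int_exp m j X : (j <= m)%N -> inL m X -> Int (fun w => X w ^+ j).
Proof.
move=> jm mX; have := @inL_mix j (m - j) X (cst 1); rewrite subnKC// => /(_ mX).
have h : inL m (cst 1) by apply: (@inL_bounded _ 1) => // w; rewrite normr1.
by move=> /(_ h); under eq_fun do rewrite expr1n mulr1.
Qed.

Lemma inL_Int m X : (0 < m)%N -> inL m X -> Int X.
Proof. by move=> m0 /(inL_Int_exp m0); under eq_fun do rewrite expr1. Qed.

(* Opaque, as unification would otherwise unfold the real powers. *)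
Let Ln_spec : {f : nat -> (T -> R) -> R |
  forall m X, f m X = (Ex (fun w => `|X w| ^+ m)) `^ (m%:R^-1)}.
Proof. by exists (fun m X => (Ex (fun w => `|X w| ^+ m)) `^ (m%:R^-1)). Qed.

Definition Ln (m : nat) X : R := sval Ln_spec m X.

Lemma LnE m X : Ln m X = (Ex (fun w => `|X w| ^+ m)) `^ (m%:R^-1).
Proof. exact: (svalP Ln_spec). Qed.

Lemma Ln_ge0 m X : 0 <= Ln m X. Proof. by rewrite LnE powR_ge0. Qed.

Lemma Ln_exp m X : (0 < m)%N -> Ln m X ^+ m = Ex (fun w => `|X w| ^+ m).
Proof.
move=> m0; rewrite -powR_mulrn ?Ln_ge0// LnE -powRrM mulVf ?pnatr_eq0 -?lt0n//.
by rewrite powRr1// Ex_ge0// => w; rewrite exprn_ge0.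
Qed.

Lemma Ln_le m X c : (0 < m)%N -> 0 <= c -> Ex (fun w => `|X w| ^+ m) <= c ^+ m -> Ln m X <= c.
Proof. by move=> m0 c0; rewrite -Ln_exp// ler_pXn2r ?nnegrE ?Ln_ge0. Qed.

Lemma LnormE m X : (0 < m)%N -> inL m X -> ('N[P]_(m%:R%:E) [EFin \o X] = (Ln m X)%:E)%E.
Proof.
move=> m0 [mX iX]; rewrite LnE unlock /= -poweR_EFin -Ex_EFin//; congr (_ `^ _)%E.
by apply: eq_integral => w _; rewrite /= powR_mulrn.
Qed.

(** The conjugate of m+1 is (m+1)/m, and |Y|^m to that power is |Y|^(m+1); so both norms are taken
    at the same exponent. *)
Lemma hoelder_exp m X Y : (0 < m)%N -> inL m.+1 X -> inL m.+1 Y ->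
  Ex (fun w => `|X w| * `|Y w| ^+ m) <= Ln m.+1 X * Ln m.+1 Y ^+ m.
Proof.
move=> m0 LX LY; have [mX iX] := LX; have [mY iY] := LY.
have m1R : m.+1%:R != 0 :> R by rewrite pnatr_eq0.
have mR : m%:R != 0 :> R by rewrite pnatr_eq0 -lt0n.
have mYm : measurable_fun setT (fun w => `|Y w| ^+ m).
  by apply: measurable_funX; exact: measurableT_comp.
have mX' : measurable_fun setT (fun w => `|X w|) by exact: measurableT_comp.
have q0 : 0 < m.+1%:R / m%:R :> R by rewrite divr_gt0 ?ltr0n.
have pq : m.+1%:R^-1 + (m.+1%:R / m%:R)^-1 = 1 :> R.
  by rewrite invf_div -[X in _ + X / _ = _](addrK 1) natr1 mulrBl divff// mul1r addrC subrK.
have p0 : 0 < m.+1%:R :> R by rewrite ltr0n.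
have := hoelder P mX' mYm p0 q0 pq.
rewrite LnormE//; last exact: inL_norm.
rewrite Lnorm1.
have -> : ('N[P]_(m.+1%:R / m%:R)%:E [EFin \o (fun w => `|Y w| ^+ m)%R] = (Ln m.+1 Y ^+ m)%:E)%E.
  rewrite LnE unlock /= -powR_mulrn ?powR_ge0// -powRrM.
  rewrite (_ : m.+1%:R^-1 * m%:R = (m.+1%:R / m%:R)^-1); last by rewrite invf_div mulrC.
  rewrite -poweR_EFin -Ex_EFin//; congr (_ `^ _)%E.
  apply: eq_integral => w _; rewrite /= ger0_norm ?exprn_ge0//.
  by rewrite -powR_mulrn// -powRrM mulrCA divff// mulr1 powR_mulrn.
have -> : Ln m.+1 (fun w => `|X w|) = Ln m.+1 X.
  by rewrite !LnE; under eq_Rintegral do rewrite normr_id.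
rewrite -EFinM -lee_fin => H; apply: le_trans H.
rewrite -Ex_EFin; last first.
  apply: (@inL_mix 1 m (fun w => `|X w|) (fun w => `|Y w|)); exact: inL_norm.
rewrite le_eqVlt; apply/orP; left; apply/eqP; apply: eq_integral => w _ /=.
by congr EFin; rewrite [RHS]ger0_norm// mulr_ge0// exprn_ge0.
Qed.

(** Measurability is taken on [g_sigma_algebraType] so that closure properties of measurable
    functions apply as they stand; it is [G]-measurability once [G] is a sigma-algebra. *)
Definition Fm (G : set (set T)) (Y : T -> R) :=
  measurable_fun [set: g_sigma_algebraType G] (Y : g_sigma_algebraType G -> R).

Lemma Fm_mono G H Y : G `<=` H -> Fm G Y -> Fm H Y.
Proof.
move=> GH mY _ B mB; have := mY measurableT B mB.
have /[apply] : <<s G >> `<=` <<s H >>; last by [].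
by apply: smallest_sub => [|A /GH]; [exact: smallest_sigma_algebra|exact: sub_sigma_algebra].
Qed.

Lemma Fm_meas G Y : G `<=` measurable -> Fm G Y -> measurable_fun setT Y.
Proof.
move=> Gm mY _ B mB; have := mY measurableT B mB.
have /[apply] : <<s G >> `<=` measurable; last by [].
by apply: smallest_sub => //; exact: sigma_algebra_measurable.
Qed.

Fixpoint running_max (s : nat -> T -> R) n : T -> R :=
  if n is i.+1 then fun w => Num.max (running_max s i w) (s i w) else cst 0.

Lemma running_max_ge0 s n w : 0 <= running_max s n w.
Proof. by elim: n => //= n IH; rewrite le_max IH. Qed.

Lemma le_running_max s n i w : (i < n)%N -> s i w <= running_max s n w.
Proof.
elim: n => //= n IH; rewrite ltnS leq_eqVlt => /predU1P[->|/IH h].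
  by rewrite le_max lexx orbT.
by rewrite le_max h.
Qed.

(* Doob's inequality in dual form, without conditional expectation of the
   dominating variables: for the (truncated) running maximum M_i of s,
   M_{i+1}^(m+2) - M_i^(m+2) <= 2 s_i (M_{i+1}^(m+1) - M_i^(m+1)), and the sum of
   the test functions on the right telescopes. *)
Section weak_doob.
Variables (m n J : nat) (F : nat -> set (set T)) (s W : nat -> T -> R).
Hypotheses (Fmeas : forall i, F i `<=` measurable)
  (Fmono : forall i j, (i <= j)%N -> F i `<=` F j)
  (sF : forall i, Fm (F i) (s i))
  (si : forall i, Int (s i))
  (W0 : forall j w, 0 <= W j w) (WL : forall j, inL m.+2 (W j))
  (sW : forall i, (i < n)%N -> forall (K : R) Y, Fm (F i) Y ->
     (forall w, 0 <= Y w <= K) ->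
     Ex (fun w => Y w * s i w) <= \sum_(j < J) Ex (fun w => Y w * W j w)).

Let mx := running_max s.
(** Each [s i] is capped at [N] so that the test functions [inc] are bounded and the norm to be
    cancelled in [tmx_le] is finite; monotone convergence removes the cap. *)
Let tmx (N : R) := running_max (fun i w => Num.min (s i w) N).

Let tmx_bound (N : R) i w : 0 <= N -> 0 <= tmx N i w <= N.
Proof.
move=> N0; elim: i => [|i /andP[h1 h2]]; first by rewrite /tmx/= lexx.
by rewrite /tmx/= -/(tmx N) le_max h1/= ge_max h2/= ge_min lexx orbT.
Qed.

Let tmxF (N : R) i : Fm (F i) (tmx N i.+1).
Proof.
elim: i => [|i IH]; apply: measurable_maxr.
- exact: measurable_cst.
- by apply: measurable_minr => //; exact: sF.
- by apply: Fm_mono _ IH; exact: Fmono.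
- by apply: measurable_minr => //; exact: sF.
Qed.

Let tmxF' (N : R) i : Fm (F i) (tmx N i).
Proof.
case: i => [|i]; first exact: measurable_cst.
by apply: Fm_mono _ (@tmxF N i); exact: Fmono.
Qed.

Let tmx_meas (N : R) i : measurable_fun setT (tmx N i).
Proof. exact: (Fm_meas (@Fmeas i) (@tmxF' N i)). Qed.

Let tmx_norm (N : R) i w : 0 <= N -> `|tmx N i w| = tmx N i w.
Proof. by move=> /(tmx_bound i w) /andP[h _]; rewrite ger0_norm. Qed.

Let tmx_inL (N : R) i k : 0 <= N -> inL k (tmx N i).
Proof.
move=> N0; apply: (@inL_bounded _ N); first exact: tmx_meas.
by move=> w; rewrite tmx_norm//; case/andP: (tmx_bound i w N0).
Qed.

Let inc (N : R) i w := tmx N i.+1 w ^+ m.+1 - tmx N i w ^+ m.+1.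

Let inc_bound (N : R) i w : 0 <= N -> 0 <= inc N i w <= N ^+ m.+1.
Proof.
move=> N0; have /andP[h1 h2] := tmx_bound i w N0; have /andP[h3 h4] := tmx_bound i.+1 w N0.
rewrite /inc subr_ge0 lerXn2r ?nnegrE//; last by rewrite /tmx/= le_max lexx.
by rewrite lerBlDr (@le_trans _ _ (N ^+ m.+1)) ?lerXn2r ?nnegrE// lerDl exprn_ge0.
Qed.

Let incF N i : Fm (F i) (inc N i).
Proof. by apply: measurable_funB; apply: measurable_funX; [exact: tmxF|exact: tmxF']. Qed.

Let inc_meas N i : measurable_fun setT (inc N i).
Proof. exact: (Fm_meas (@Fmeas i) (@incF N i)). Qed.

(** Either the maximum does not move and both sides vanish, or its new value is [Num.min (s i w) N],
    which is at most [s i w]. *)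
Let tmx_step (N : R) i w : 0 <= N ->
  tmx N i.+1 w ^+ m.+2 - tmx N i w ^+ m.+2 <= 2 * (inc N i w * s i w).
Proof.
move=> N0; have /andP[h1 _] := tmx_bound i w N0.
have h2 : tmx N i w <= tmx N i.+1 w by rewrite /tmx/= le_max lexx.
apply: (le_trans (expr_increment_le _ h1 h2)); rewrite ler_wpM2l//.
rewrite -/(inc N i w) mulrC.
have [e|ne] := eqVneq (tmx N i.+1 w) (tmx N i w); first by rewrite /inc e subrr !mul0r.
apply: ler_wpM2l; first by case/andP: (inc_bound i w N0).
move: ne; rewrite /tmx/= -/(tmx N).
have [h|h _] := leP (Num.min (s i w) N) (tmx N i w); first by rewrite eqxx.
by rewrite ge_min lexx.
Qed.

Let B := \sum_(j < J) Ln m.+2 (W j).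

Let B0 : 0 <= B. Proof. by apply: sumr_ge0 => i _; exact: Ln_ge0. Qed.

Let tmx_le (N : R) : 0 <= N -> Ex (fun w => tmx N n w ^+ m.+2) <= (2 * B) ^+ m.+2.
Proof.
move=> N0.
have incK i w : `|inc N i w| <= N ^+ m.+1.
  by have /andP[h1 h2] := inc_bound i w N0; rewrite ger0_norm.
have i1 i : Int (fun w => inc N i w * s i w) by apply: (@Int_mulB (N ^+ m.+1)) => //; exact: inc_meas.
have WI j : Int (W j) by exact: inL_Int (WL j).
have i2 i j : Int (fun w => inc N i w * W j w) by apply: (@Int_mulB (N ^+ m.+1)) => //; exact: inc_meas.
have i3 i k : Int (fun w => tmx N i w ^+ k).
  by apply: (@inL_Int_exp k) => //; exact: tmx_inL.
have sum_inc w k : \sum_(i < n) (tmx N i.+1 w ^+ k.+1 - tmx N i w ^+ k.+1) = tmx N n w ^+ k.+1.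
  rewrite -(big_mkord xpredT (fun i => tmx N i.+1 w ^+ k.+1 - tmx N i w ^+ k.+1)).
  by rewrite telescope_sumr// [X in _ - X](_ : _ = 0) ?subr0// /tmx/= expr0n.
have H1 : Ex (fun w => tmx N n w ^+ m.+2) <= \sum_(i < n) 2 * Ex (fun w => inc N i w * s i w).
  have -> : \sum_(i < n) 2 * Ex (fun w => inc N i w * s i w) =
      Ex (fun w => \sum_(i < n) 2 * (inc N i w * s i w)).
    by rewrite Ex_sum => [|i]; [apply: eq_bigr => i _; rewrite ExZ|exact: IntZ].
  apply: Ex_le => //; first by apply: Int_sum => i _; exact: IntZ.
  by move=> w; rewrite -sum_inc; apply: ler_sum => i _; exact: tmx_step.
have H2 : \sum_(i < n) 2 * Ex (fun w => inc N i w * s i w) <=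
    2 * \sum_(j < J) Ex (fun w => tmx N n w ^+ m.+1 * W j w).
  rewrite -mulr_sumr ler_wpM2l//.
  have -> : \sum_(j < J) Ex (fun w => tmx N n w ^+ m.+1 * W j w) =
      \sum_(i < n) \sum_(j < J) Ex (fun w => inc N i w * W j w).
    rewrite exchange_big/=; apply: eq_bigr => j _; rewrite -Ex_sum//.
    by apply: eq_Rintegral => w _; rewrite -mulr_suml sum_inc.
  apply: ler_sum => i _; apply: (@sW i (ltn_ord i) (N ^+ m.+1) (inc N i)); first exact: incF.
  by move=> w; exact: inc_bound.
have H3 : \sum_(j < J) Ex (fun w => tmx N n w ^+ m.+1 * W j w) <= B * Ln m.+2 (tmx N n) ^+ m.+1.
  rewrite /B mulr_suml; apply: ler_sum => j _.
  apply: le_trans (@hoelder_exp m.+1 _ _ _ _ _) => //; last exact: tmx_inL.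
  rewrite le_eqVlt; apply/orP; left; apply/eqP/eq_Rintegral => w _.
  by rewrite (ger0_norm (W0 _ _)) tmx_norm// mulrC.
have LE : Ln m.+2 (tmx N n) ^+ m.+2 = Ex (fun w => tmx N n w ^+ m.+2).
  by rewrite Ln_exp//; apply: eq_Rintegral => w _; rewrite tmx_norm.
rewrite -LE lerXn2r ?nnegrE ?Ln_ge0 ?mulr_ge0//.
(* Hölder's inequality has left the power m+1 of the norm on the right; cancelling it leaves the
   norm itself. *)
have [->|nz] := eqVneq (Ln m.+2 (tmx N n)) 0; first by rewrite mulr_ge0.
have lp : 0 < Ln m.+2 (tmx N n) by rewrite lt_neqAle eq_sym nz Ln_ge0.
rewrite -(ler_pM2r (exprn_gt0 m.+1 lp)) -exprS LE.
by apply: (le_trans H1); apply: (le_trans H2); rewrite -mulrA ler_wpM2l.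
Qed.

Lemma weak_doob : inL m.+2 (mx n) /\ Ln m.+2 (mx n) <= 2 * \sum_(j < J) Ln m.+2 (W j).
Proof.
have mx0 i w : 0 <= mx i w by exact: running_max_ge0.
have mxm : measurable_fun setT (mx n).
  elim: n => [|k IH]; first exact: measurable_cst.
  by apply: measurable_maxr => //; apply: (Fm_meas (@Fmeas k)).
have nd (N1 N2 : R) i w : N1 <= N2 -> tmx N1 i w <= tmx N2 i w.
  move=> N12; rewrite /tmx; elim: i => [//|i IH] /=.
  rewrite ge_max !le_max IH/=; apply/orP; right.
  by rewrite le_min !ge_min lexx N12 orbT.
have ev (N : R) i w : mx i w <= N -> tmx N i w = mx i w.
  rewrite /tmx /mx; elim: i => [//|i IH] /=.
  rewrite ge_max => /andP[h1 h2]; rewrite IH//; congr Num.max.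
  exact/min_idPl.
have key : (\int[P]_w (mx n w ^+ m.+2)%:E <= ((2 * B) ^+ m.+2)%:E)%E.
  pose g k w := (tmx k%:R n w ^+ m.+2)%:E.
  have mg k : measurable_fun setT (g k).
    by apply/measurable_EFinP; apply: measurable_funX; exact: tmx_meas.
  have g0 k w : setT w -> (0 <= g k w)%E.
    by move=> _; rewrite lee_fin exprn_ge0//; case/andP: (tmx_bound n w (ler0n R k)).
  have gnd w : setT w -> nondecreasing_seq (g ^~ w).
    move=> _ a b ab; rewrite lee_fin lerXn2r ?nnegrE ?nd ?ler_nat//.
      by case/andP: (tmx_bound n w (ler0n R a)).
    by case/andP: (tmx_bound n w (ler0n R b)).
  have := @cvg_monotone_convergence _ T R P setT measurableT g mg g0 gnd.
  have -> : (fun x => limn (g ^~ x)) = (fun w => (mx n w ^+ m.+2)%:E).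
    apply/funext => w; apply/cvg_lim => //; apply: cvg_near_cst.
    (* A cap above the running maximum changes nothing, so at each point the sequence is eventually
       constant. *)
    exists (Num.truncn (mx n w)).+1 => // k /= tk; rewrite /g ev//.
    by rewrite (le_trans (ltW (truncnS_gt _)))// ler_nat.
  move=> cv; rewrite -(cvg_lim _ cv)//; apply: lime_le; first by apply/cvg_ex; eexists; exact: cv.
  apply: nearW => k; rewrite /g Ex_EFin ?lee_fin ?tmx_le//.
  by apply: (@inL_Int_exp m.+2) => //; exact: tmx_inL.
have iM : Int (fun w => `|mx n w| ^+ m.+2).
  apply/integrableP; split.
    by apply/measurable_EFinP/measurable_funX; exact: measurableT_comp.
  under eq_integral => w _ do rewrite /= normrX normr_id (ger0_norm (mx0 _ _)).
  by apply: (le_lt_trans key); rewrite ltry.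
split; first by split.
apply: Ln_le => //; first by rewrite mulr_ge0.
rewrite -lee_fin -Ex_EFin//; apply: le_trans key.
by under eq_integral => w _ do rewrite (ger0_norm (mx0 _ _)).
Qed.

End weak_doob.
End lp.

(** * Testing conditional expectations *)

Import HBNNSimple.

Section condexp_duality.
Context d (T : measurableType d) (R : realType) (P : probability T R).
Implicit Types X Y Z D : T -> R.
Local Notation Ex X := (Rintegral P setT X).
Local Notation Int X := (P.-integrable setT (EFin \o X)).
Variable G : set (set T).
Hypotheses (sG : sigma_algebra setT G) (Gm : G `<=` measurable).

Let GE : (@measurable _ (g_sigma_algebraType G) : set (set T)) = G.
Proof. by rewrite measurable_g_measurableTypeE. Qed.

Lemma Ex_indic (A : set T) Z : measurable A ->
  Ex (fun w => \1_A w * Z w) = (\int[P]_(w in A) Z w)%R.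
Proof.
move=> mA; rewrite [RHS]Rintegral_mkcond; apply: eq_Rintegral => w _.
by rewrite patchE indicE; case: ifP; rewrite ?mul1r ?mul0r.
Qed.

Section zero.
Variable Z : T -> R.
Hypotheses (iZ : Int Z) (Z0 : forall A, G A -> Ex (fun w => \1_A w * Z w) = 0).

Let zero_ge0 Y : Fm G Y -> (forall w, 0 <= Y w) -> Int (fun w => Y w * Z w) ->
  Ex (fun w => Y w * Z w) = 0.
Proof.
move=> mY Y0 iYZ.
(* Approximating [Y] on the space carrying [G] puts the level sets of the simple functions in [G],
   where [Z] integrates to zero. *)
pose TG : measurableType G.-sigma := g_sigma_algebraType G.
pose f : TG -> \bar R := EFin \o Y.
have mf : measurable_fun setT f by exact/measurable_EFinP.
pose g n : T -> R := @nnsfun_approx _ TG R setT measurableT f mf n.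
have f0 x : setT x -> (0 <= f x)%E by rewrite lee_fin Y0.
have g0 n w : 0 <= g n w by exact: fun_ge0.
have gY n w : g n w <= Y w.
  by rewrite -lee_fin /g nnsfun_approxE; exact: (le_approx n f0).
have gcv w : g ^~ w @ \oo --> Y w.
  rewrite /g; under eq_fun do rewrite nnsfun_approxE.
  by apply: (cvg_approx f0) => //; rewrite ltry.
have mg n : measurable_fun (setT : set TG) (g n : TG -> R) by exact: measurable_funP.
have mg' n : measurable_fun (setT : set T) (g n : T -> R) by exact: (Fm_meas Gm (@mg n)).
have Gg n (y : R) : G (g n @^-1` [set y]).
  have := mg n measurableT [set y] (measurable_set1 y).
  by rewrite setTI measurable_g_measurableTypeE.
have Eg n : Ex (fun w => g n w * Z w) = 0.
  pose r := finmap.enum_fset (fset_set (range (g n))).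
  have gE w : g n w = \sum_(y <- r) y * \1_(g n @^-1` [set y]) w.
    by rewrite {1}/g fimfunE fsbig_finite//; exact: fimfunP.
  have iI (y : R) : Int (fun w => \1_(g n @^-1` [set y]) w * Z w).
    apply: (@Int_mulB _ T R P 1) => // [|w].
      by apply: measurable_indic; exact: Gm.
    by rewrite ger0_norm// indicE lern1 leq_b1.
  have -> : Ex (fun w => g n w * Z w) =
      Ex (fun w => \sum_(y <- r) y * (\1_(g n @^-1` [set y]) w * Z w)).
    apply: eq_Rintegral => w _; rewrite gE mulr_suml.
    by apply: eq_bigr => y _; rewrite mulrA.
  rewrite Ex_sum => [|y]; last exact: IntZ.
  by apply: big1 => y _; rewrite ExZ// Z0 ?mulr0//.
have ig n : Int (fun w => g n w * Z w).
  apply: (@Int_le _ T R P _ (fun w => `|Y w * Z w|)).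
  - by apply: measurable_funM => //; exact: Int_meas iZ.
  - by move=> w; rewrite !normrM ler_wpM2r// !ger0_norm.
  - exact: integrable_norm.
have mF n : measurable_fun setT (fun w : T => (g n w * Z w)%:E).
  exact: (measurable_int P (ig n)).
have mL : measurable_fun setT (fun w => (Y w * Z w)%:E).
  exact: (measurable_int P iYZ).
have cF : {ae P, forall w, setT w -> (fun n => (g n w * Z w)%:E) @ \oo --> (Y w * Z w)%:E}.
  apply: aeW => w _; apply/fine_cvgP; split; first exact: nearW.
  by apply: cvgMr_tmp; exact: gcv.
have dF : {ae P, forall w n, setT w -> (`|(g n w * Z w)%:E| <= (`|Y w * Z w|)%:E)%E}.
  apply: aeW => w n _; rewrite /= lee_fin !normrM ler_wpM2r// !ger0_norm//.
have [_ _] := @dominated_convergence _ T R P setT measurableT _ _ _ mF mL cF (integrable_norm iYZ) dF.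
have -> : [sequence (\int[P]_w (g n w * Z w)%:E)%E]_n = cst 0%E.
  by apply/funext => n /=; rewrite Ex_EFin// Eg.
move=> /(cvg_unique _ (cvg_cst _)) h.
by rewrite /Rintegral -h.
Qed.

Lemma condexp_zero Y : Fm G Y -> Int (fun w => Y w * Z w) -> Ex (fun w => Y w * Z w) = 0.
Proof.
move=> mY iYZ.
have mYT := Fm_meas Gm mY.
have mp : Fm G (fun w => Num.max (Y w) 0) by apply: measurable_maxr.
have mn : Fm G (fun w => Num.max (- Y w) 0).
  by apply: measurable_maxr => //; exact: measurableT_comp.
have ip : Int (fun w => Num.max (Y w) 0 * Z w).
  apply: (@Int_le _ T R P _ (fun w => `|Y w * Z w|)); last exact: integrable_norm.
    by apply: measurable_funM; [exact: Fm_meas mp|exact: Int_meas iZ].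
  move=> w; rewrite !normrM ler_wpM2r// ger0_norm ?le_max ?lexx ?orbT//.
  by rewrite ge_max ler_norm normr_ge0.
have im : Int (fun w => Num.max (- Y w) 0 * Z w).
  apply: (@Int_le _ T R P _ (fun w => `|Y w * Z w|)); last exact: integrable_norm.
    by apply: measurable_funM; [exact: Fm_meas mn|exact: Int_meas iZ].
  move=> w; rewrite !normrM ler_wpM2r// ger0_norm ?le_max ?lexx ?orbT//.
  by rewrite ge_max -normrN ler_norm normr_ge0.
have -> : Ex (fun w => Y w * Z w) =
    Ex (fun w => Num.max (Y w) 0 * Z w - Num.max (- Y w) 0 * Z w).
  apply: eq_Rintegral => w _; rewrite -mulrBl; congr (_ * _).
  by have [h|h] := leP (Y w) 0; [rewrite max_l ?oppr_ge0// sub0r opprK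
    |rewrite max_r ?subr0// oppr_le0 ltW].
by rewrite ExB// !zero_ge0 ?subr0// => w; rewrite le_max lexx orbT.
Qed.

End zero.

(** [X - D] integrates to zero over the sets of [G], hence against [Y] by [condexp_zero]. [Y] may be
    unbounded, since powers of partial sums serve as test functions. *)
Lemma condexp_test X D Y : is_condexp P G X D -> Int X -> Fm G Y ->
  Int (fun w => Y w * X w) -> Int (fun w => Y w * D w) ->
  Ex (fun w => Y w * X w) = Ex (fun w => Y w * D w).
Proof.
move=> [mD iD DX] iX mY iYX iYD.
have bI A Z : G A -> Int Z -> Int (fun w => \1_A w * Z w).
  move=> GA iZ; apply: (@Int_mulB _ T R P 1) => // [|w].
    by apply: measurable_indic; exact: Gm.
  by rewrite ger0_norm// indicE lern1 leq_b1.
apply/eqP; rewrite -subr_eq0 -ExB//; apply/eqP.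
have -> : Ex (fun w => Y w * X w - Y w * D w) = Ex (fun w => Y w * (X w - D w)).
  by apply: eq_Rintegral => w _; rewrite mulrBr.
apply: condexp_zero => //; first exact: IntB.
  move=> A GA.
  have -> : Ex (fun w => \1_A w * (X w - D w)) = Ex (fun w => \1_A w * X w - \1_A w * D w).
    by apply: eq_Rintegral => w _; rewrite mulrBr.
  rewrite ExB ?bI// !Ex_indic; [|exact: Gm..].
  by rewrite /Rintegral DX ?subrr.
have := IntB iYX iYD; apply: eq_integrable => // w _ /=.
by rewrite mulrBr.
Qed.

Lemma condexp_testB K X D Y : is_condexp P G X D -> Int X -> Fm G Y ->
  (forall w, `|Y w| <= K) -> Ex (fun w => Y w * X w) = Ex (fun w => Y w * D w).
Proof.
move=> cD iX mY YK; have mYT := Fm_meas Gm mY.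
apply: condexp_test => //; apply: (Int_mulB mYT YK) => //.
by case: cD.
Qed.

Lemma is_condexp_Fm X D : is_condexp P G X D -> Fm G D.
Proof. by move=> [mD _ _] _ B mB; rewrite setTI GE; exact: mD. Qed.

Lemma Fm_norm Y : Fm G Y -> Fm G (fun w => `|Y w|).
Proof. by move=> mY; apply: measurableT_comp mY; exact: normr_measurable. Qed.

(** This is [Y] times the sign of [D]: integrated against [D] it gives the integral of [Y] against
    |D|, without changing |Y|. *)
Lemma Fm_flip Y D : Fm G Y -> Fm G D -> Fm G (fun w => if 0 <= D w then Y w else - Y w).
Proof.
move=> mY mD; apply: measurable_fun_ifT => //; last exact: measurableT_comp.
by apply: measurable_fun_ler.
Qed.

(* The case n = 1 of [weak_doob]; up to the factor 2 it plays the role of the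
   inequalities of Jensen and Minkowski. *)
Lemma Ln_dual r J (W : nat -> T -> R) D : Fm G D -> Int D ->
  (forall j w, 0 <= W j w) -> (forall j, inL P r.+2 (W j)) ->
  (forall K Y, Fm G Y -> (forall w, `|Y w| <= K) ->
    Ex (fun w => Y w * D w) <= \sum_(j < J) Ex (fun w => `|Y w| * W j w)) ->
  inL P r.+2 D /\ Ln P r.+2 D <= 2 * \sum_(j < J) Ln P r.+2 (W j).
Proof.
move=> mD iD W0 WL H.
have [h1 h2] : inL P r.+2 (running_max (fun _ w => `|D w|) 1) /\
    Ln P r.+2 (running_max (fun _ w => `|D w|) 1) <= 2 * \sum_(j < J) Ln P r.+2 (W j).
  apply: (@weak_doob _ T R P r 1 J (fun=> G) (fun _ w => `|D w|) W).
  - by move=> _.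
  - by move=> *.
  - by move=> _; exact: Fm_norm.
  - by move=> _; exact: integrable_norm.
  - exact: W0.
  - exact: WL.
  - move=> _ _ K Y mY YK.
    have Y0 w : 0 <= Y w by case/andP: (YK w).
    have nY w : `|if 0 <= D w then Y w else - Y w| = Y w.
      by case: ifP => _; rewrite ?normrN ger0_norm.
    have nK w : `|if 0 <= D w then Y w else - Y w| <= K by rewrite nY; case/andP: (YK w).
    have := H K _ (Fm_flip mY mD) nK.
    rewrite (_ : Ex _ = Ex (fun w => Y w * `|D w|)); last first.
      apply: eq_Rintegral => w _; case: ifP => [h|/negbT]; first by rewrite ger0_norm.
      by rewrite -ltNge => /ltr0_norm ->; rewrite mulNr mulrN.
    move=> /le_trans; apply; rewrite le_eqVlt; apply/orP; left; apply/eqP.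
    by apply: eq_bigr => j _; apply: eq_Rintegral => w _; rewrite nY.
split.
  apply: inL_le h1; first exact: (Fm_meas Gm mD).
  by move=> w; rewrite [leRHS]ger0_norm ?running_max_ge0//= le_max lexx orbT.
suff <- : Ln P r.+2 (running_max (fun=> fun w => `|D w|) 1) = Ln P r.+2 D by exact: h2.
rewrite !LnE; congr (_ `^ _); apply: eq_Rintegral => w _ /=.
by rewrite max_r// normr_id.
Qed.

(** In the duality of [Ln_dual], the single variable |X| dominates [D]. *)
Lemma Ln_condexp r X D : is_condexp P G X D -> inL P r.+2 X -> inL P r.+2 D.
Proof.
move=> cD LX; have iX : Int X by exact: inL_Int LX.
have mD := is_condexp_Fm cD.
have iD : Int D by case: cD.
apply: (proj1 (@Ln_dual r 1 (fun=> fun w => `|X w|) D mD iD (fun _ w => normr_ge0 _)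
  (fun=> inL_norm LX) _)) => K Y mY YK; have mYT := Fm_meas Gm mY.
rewrite big_ord1 -(condexp_testB cD iX mY YK).
have iYX := Int_mulB mYT YK iX.
apply: Ex_le => // [|w].
  by have := integrable_norm iYX; apply: eq_integrable => // w _; rewrite /= normrM.
by rewrite -normrM ler_norm.
Qed.

End condexp_duality.

(** * The moment recursion *)

Lemma norm_even_expr (R : realDomainType) n (x : R) : ~~ odd n -> `|x| ^+ n = x ^+ n.
Proof. by move=> on; rewrite -normrX ger0_norm// real_exprn_even_ge0 ?num_real. Qed.

Lemma sqrD_test_le (R : realDomainType) (y a b : R) :
  y * (a + b) ^+ 2 <= 2 * (`|y| * a ^+ 2) + 2 * (`|y| * b ^+ 2).
Proof.
apply: (@le_trans _ _ (`|y| * (a + b) ^+ 2)); first by rewrite ler_wpM2r ?sqr_ge0 ?ler_norm.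
have := mulr_ge0 (normr_ge0 y) (sqr_ge0 (a - b)).
by move: `|y| => z; rewrite !expr2; lra.
Qed.

Lemma div_double_le (R : realFieldType) (a' a b c y z x : R) : 0 < x ->
  a' <= 2 * a + 2 * y * b + 2 * z * c -> a' / (2 * x) <= a / x + y * (b / x) + z * (c / x).
Proof.
move=> x0 H; rewrite ler_pdivrMr ?mulr_gt0//.
rewrite (_ : _ * (2 * x) = 2 * a + 2 * y * b + 2 * z * c)//.
by field; rewrite gt_eqF.
Qed.

Lemma combine_le (R : realDomainType) (a b x y z c1 c2 c3 : R) :
  a <= 3 * x + c1 * y + c3 * z -> b <= c2 * y -> 0 <= y -> 0 <= z -> 0 <= x ->
  0 <= c1 -> 0 <= c2 -> 0 <= c3 -> a + b <= (3 + c1 + c2 + c3) * (x + y + z).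
Proof.
move=> ha hb y0 z0 x0 c10 c20 c30.
have h1 := mulr_ge0 c10 x0; have h2 := mulr_ge0 c10 z0; have h3 := mulr_ge0 c20 x0.
have h4 := mulr_ge0 c20 z0; have h5 := mulr_ge0 c30 x0; have h6 := mulr_ge0 c30 y0.
lra.
Qed.

Section lp_extra.
Context d (T : measurableType d) (R : realType) (P : probability T R).
Implicit Types X Y : T -> R.
Local Notation Ex X := (Rintegral P setT X).
Local Notation Int X := (P.-integrable setT (EFin \o X)).

Lemma Ln_norm m X : Ln P m (fun w => `|X w|) = Ln P m X.
Proof. by rewrite !LnE; congr (_ `^ _); apply: eq_Rintegral => w _; rewrite normr_id. Qed.

Lemma Ln_sqr m X : (0 < m)%N -> Ln P m (fun w => X w ^+ 2) = Ln P (2 * m) X ^+ 2.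
Proof.
move=> m0; apply/eqP; rewrite -(@eqrXn2 _ m) ?Ln_ge0 ?exprn_ge0 ?Ln_ge0//.
rewrite -exprM !Ln_exp ?muln_gt0//; apply/eqP/eq_Rintegral => w _.
by rewrite normrX -exprM.
Qed.

Lemma Ex_test_le K X Y : measurable_fun setT Y -> (forall w, `|Y w| <= K) -> Int X ->
  Ex (fun w => Y w * X w) <= Ex (fun w => `|Y w| * `|X w|).
Proof.
move=> mY YK iX; apply: Ex_le => [||w]; last by rewrite -normrM ler_norm.
  exact: Int_mulB YK iX.
apply: (@Int_mulB _ T R P K) => [|w|]; [exact: measurableT_comp|by rewrite normr_id|].
exact: integrable_norm.
Qed.

Lemma inL_running_max m (s : nat -> T -> R) n : (forall i, inL P m (s i)) -> (forall i w, 0 <= s i w) ->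
  inL P m (running_max s n).
Proof.
move=> sL s0; have mr i : measurable_fun setT (running_max s i).
  by elim: i => [|i IH] /=; [exact: measurable_cst|apply: measurable_maxr => //; case: (sL i)].
apply: (@inL_le _ T R P _ _ (fun w => \sum_(i < n) s i w)) => // [w|]; last exact: inL_sum.
rewrite !ger0_norm ?running_max_ge0 ?sumr_ge0//.
elim: n => [|n IH] /=; first by rewrite big_ord0.
rewrite big_ord_recr/= ge_max (le_trans IH) ?lerDl//= lerDr sumr_ge0//.
Qed.

Lemma running_max_exp_le m (s : nat -> T -> R) n w : (forall i, 0 <= s i w) ->
  running_max s n w ^+ m.+1 <= \sum_(i < n) s i w ^+ m.+1 :> R.
Proof.
move=> s0; elim: n => [|n IH] /=; first by rewrite big_ord0 expr0n.
rewrite big_ord_recr/=; have [h|h] := leP (running_max s n w) (s n w).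
  by rewrite lerDr sumr_ge0// => i _; rewrite exprn_ge0.
by apply: (le_trans IH); rewrite lerDl exprn_ge0.
Qed.

Lemma running_max_le (s : nat -> T -> R) n w c : 0 <= c -> (forall i, (i < n)%N -> s i w <= c) ->
  running_max s n w <= c.
Proof.
move=> c0; elim: n => [//|n IH] H /=; rewrite ge_max H// IH// => i ni.
by apply: H; exact: leqW.
Qed.

End lp_extra.

(** * Doubling and maxima for abstract adapted partial sums *)

Section partial_sums.
Context d (T : measurableType d) (R : realType) (P : probability T R).
Local Notation Ex X := (Rintegral P setT X).
Local Notation Int X := (P.-integrable setT (EFin \o X)).
Variables (h : nat) (F : nat -> set (set T)) (S : nat -> T -> R)
  (D V : nat -> nat -> T -> R).
Local Notation p := (h.*2.+4).
Local Notation m := (h.+2).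
Let I k j : T -> R := fun w => S (k + j)%N w - S k w.

Hypotheses (sF : forall k, sigma_algebra setT (F k))
  (Fmeas : forall k, F k `<=` measurable)
  (Fmono : forall i j, (i <= j)%N -> F i `<=` F j)
  (S0 : forall w, S 0 w = 0) (SF : forall k, Fm (F k) (S k))
  (SL : forall k, inL P p (S k))
  (DP : forall k j, is_condexp P (F k) (I k j) (D k j))
  (VP : forall k j, is_condexp P (F k) (fun w => I k j w ^+ 2) (V k j)).

Let p2m : (2 * m)%N = p. Proof. by rewrite mul2n. Qed.

Let IL k j : inL P p (I k j).
Proof. by apply: inLD; [exact: SL|exact: inLN]. Qed.

Let II k j : Int (I k j). Proof. exact: inL_Int (IL k j). Qed.

Let I2L k j : inL P m (fun w => I k j w ^+ 2).
Proof. by apply: inL_exp; rewrite p2m. Qed.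

Let I2I k j : Int (fun w => I k j w ^+ 2). Proof. exact: inL_Int (I2L k j). Qed.

Let DL k j : inL P p (D k j).
Proof. exact: (Ln_condexp (sF k) (@Fmeas k) (DP k j) (IL k j)). Qed.

Let VL k j : inL P m (V k j).
Proof. exact: (Ln_condexp (sF k) (@Fmeas k) (VP k j) (I2L k j)). Qed.

Let DI k j : Int (D k j). Proof. exact: inL_Int (DL k j). Qed.
Let VI k j : Int (V k j). Proof. exact: inL_Int (VL k j). Qed.

Let I_split i j w : I 0 (i + j) w = I 0 i w + I i j w.
Proof. by rewrite /I !add0n; ring. Qed.

Let u k := Ln P p (D 0 k).
Let v k := Ln P m (V 0 k).

Hypotheses (DE : forall k j, Ln P p (D k j) = u j)
  (VE : forall k j, Ln P m (V k j) = v j).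

(** The tower property in dual form: a test function of the past of 0 is also one of the past of
    [i], so the increment after [i] is replaced directly by [D i j], whose norm is [u j]. The factor
    2 is that of [Ln_dual]. *)
Let u_sub i j : u (i + j) <= 2 * (u i + u j).
Proof.
pose W := nth (cst 0 : T -> R) [:: (fun w => `|D 0 i w|); (fun w => `|D i j w|)].
have [|||_] := @Ln_dual _ T R P _ (@Fmeas 0) h.*2.+2 2 W (D 0 (i + j))
  (is_condexp_Fm (sF 0) (DP 0 (i + j))) (DI _ _).
- by move=> [|[|l]] w; rewrite /W /= ?nth_nil ?normr_ge0.
- by move=> [|[|l]]; [exact: inL_norm|exact: inL_norm|rewrite /W/= nth_nil; exact: inL0].
- move=> K Y mY YK; rewrite !big_ord_recl big_ord0 addr0 /W /=.
  have mYT := Fm_meas (@Fmeas 0) mY.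
  have mYi : Fm (F i) Y by apply: Fm_mono mY; exact: Fmono.
  rewrite -(condexp_testB (sF 0) (@Fmeas 0) (DP 0 (i + j)) (II _ _) mY YK).
  have -> : Ex (fun w => Y w * I 0 (i + j) w) = Ex (fun w => Y w * I 0 i w + Y w * I i j w).
    by apply: eq_Rintegral => w _; rewrite I_split mulrDr.
  rewrite ExD; [|exact: Int_mulB YK (II _ _)..].
  rewrite (condexp_testB (sF 0) (@Fmeas 0) (DP 0 i) (II _ _) mY YK).
  rewrite (condexp_testB (sF i) (@Fmeas i) (DP i j) (II _ _) mYi YK).
  by apply: lerD; exact: Ex_test_le YK (DI _ _).
- rewrite big_ord_recl big_ord1 /W /=.
  by rewrite (Ln_norm _ _ (D 0 i)) (Ln_norm _ _ (D i j)) (DE i j).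
Qed.

Let v_sub i j : v (i + j) <= 4 * (v i + v j).
Proof.
(* Each bound occurs twice because of [(a + b)^2 <= 2 a^2 + 2 b^2]. *)
pose W := nth (cst 0 : T -> R) [:: (fun w => `|V 0 i w|); (fun w => `|V 0 i w|);
  (fun w => `|V i j w|); (fun w => `|V i j w|)].
have [|||_] := @Ln_dual _ T R P _ (@Fmeas 0) h 4 W (V 0 (i + j))
  (is_condexp_Fm (sF 0) (VP 0 (i + j))) (VI _ _).
- by move=> [|[|[|[|l]]]] w; rewrite /W /= ?nth_nil ?normr_ge0.
- by move=> [|[|[|[|l]]]]; [exact: inL_norm..|rewrite /W/= nth_nil; exact: inL0].
- move=> K Y mY YK; rewrite !big_ord_recl big_ord0 addr0 /W /=.
  have mYT := Fm_meas (@Fmeas 0) mY.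
  have mY' : Fm (F 0) (fun w => `|Y w|) by exact: Fm_norm.
  have mYi : Fm (F i) (fun w => `|Y w|) by apply: Fm_mono mY'; exact: Fmono.
  have mYT' := Fm_meas (@Fmeas 0) mY'.
  have YK' w : `|(`|Y w|)| <= K by rewrite normr_id.
  have eV k l : Fm (F k) (fun w => `|Y w|) ->
      Ex (fun w => `|Y w| * I k l w ^+ 2) <= Ex (fun w => `|Y w| * `|V k l w|).
    move=> mYk; rewrite (condexp_testB (sF k) (@Fmeas k) (VP k l) (I2I _ _) mYk YK').
    apply: le_trans (Ex_test_le mYT' YK' (VI k l)) _.
    by under eq_Rintegral do rewrite normr_id.
  rewrite -(condexp_testB (sF 0) (@Fmeas 0) (VP 0 (i + j)) (I2I _ _) mY YK).
  have iY k l : Int (fun w => `|Y w| * I k l w ^+ 2) by exact: Int_mulB YK' (I2I _ _).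
  apply: (@le_trans _ _ (Ex (fun w => 2 * (`|Y w| * I 0 i w ^+ 2) + 2 * (`|Y w| * I i j w ^+ 2)))).
    apply: Ex_le.
    + exact: Int_mulB YK (I2I _ _).
    + by apply: IntD; exact: IntZ.
    + move=> w; rewrite I_split.
      exact: sqrD_test_le.
  rewrite ExD ?ExZ//; [|exact: IntZ..].
  have := eV 0 i mY'; have := eV i j mYi.
  move: (Ex _) (Ex _) (Ex _) (Ex _) => a b c e; lra.
- rewrite 3!big_ord_recl big_ord1 /W /=.
  rewrite (Ln_norm _ _ (V 0 i)) (Ln_norm _ _ (V i j)) (VE i j) -/(v i) => /le_trans; apply.
  by move: (v i) (v j) => a b; lra.
Qed.

(** In this section stationarity appears as equalities of norms at different times, and
    reversibility as the two moment identities [rev1] and [rev2]. *)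
Hypothesis SE : forall k j, Ln P p (I k j) = Ln P p (S j).
Hypotheses
  (rev1 : forall j, Ex (fun w => S j w * I j j w ^+ h.*2.+3) =
                    Ex (fun w => S j w ^+ h.*2.+3 * I j j w))
  (rev2 : forall j, Ex (fun w => S j w ^+ 2 * I j j w ^+ h.*2.+2) =
                    Ex (fun w => S j w ^+ h.*2.+2 * I j j w ^+ 2)).

Let L k := Ln P p (S k).

Let cross1 j : Ex (fun w => S j w ^+ h.*2.+3 * I j j w) <= L j ^+ h.*2.+3 * u j.
Proof.
have mY : Fm (F j) (fun w => S j w ^+ h.*2.+3) by apply: measurable_funX; exact: SF.
have mix X : inL P p X -> Int (fun w => S j w ^+ h.*2.+3 * X w).
  move=> LX; have := @inL_mix _ T R P h.*2.+3 1 (S j) X; rewrite addn1.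
  exact.
rewrite (condexp_test (sF j) (@Fmeas j) (DP j j) (II j j) mY (mix _ (IL j j)) (mix _ (DL j j))).
rewrite mulrC -(DE j j); apply: le_trans (@hoelder_exp _ T R P h.*2.+3 (D j j) (S j) _ _ _) => //.
apply: Ex_le; first exact: mix.
  have := integrable_norm (mix _ (DL j j)); apply: eq_integrable => // w _.
  by rewrite /= normrM normrX mulrC.
by move=> w; rewrite mulrC -normrX -normrM ler_norm.
Qed.

Let cross2 j : Ex (fun w => S j w ^+ h.*2.+2 * I j j w ^+ 2) <= L j ^+ h.*2.+2 * v j.
Proof.
have mY : Fm (F j) (fun w => S j w ^+ h.*2.+2) by apply: measurable_funX; exact: SF.
have S2L : inL P m (fun w => S j w ^+ 2) by apply: inL_exp; rewrite p2m.
(* Since p - 2 = 2 (p/2 - 1), Hölder's inequality is applied at p/2 to [V j j] and the square of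
   [S j]. *)
have e w : S j w ^+ h.*2.+2 = (S j w ^+ 2) ^+ h.+1 by rewrite -exprM mul2n.
have mix X : inL P m X -> Int (fun w => S j w ^+ h.*2.+2 * X w).
  move=> LX; have := @inL_mix _ T R P h.+1 1 (fun w => S j w ^+ 2) X; rewrite addn1.
  move=> /(_ S2L LX); apply: eq_integrable => // w _ /=.
  by rewrite e expr1.
rewrite (condexp_test (sF j) (@Fmeas j) (VP j j) (I2I j j) mY (mix _ (I2L j j)) (mix _ (VL j j))).
have -> : L j ^+ h.*2.+2 * v j = Ln P m (V j j) * Ln P m (fun w => S j w ^+ 2) ^+ h.+1.
  by rewrite Ln_sqr// p2m -exprM mul2n VE mulrC.
apply: le_trans (@hoelder_exp _ T R P h.+1 (V j j) (fun w => S j w ^+ 2) _ _ _) => //.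
apply: Ex_le; first exact: mix.
  have := integrable_norm (mix _ (VL j j)); apply: eq_integrable => // w _.
  by rewrite /= normrM e normrX mulrC.
by move=> w; rewrite e mulrC -normrX -normrM ler_norm.
Qed.

Let even_p : ~~ odd p. Proof. by rewrite /= !negbK odd_double. Qed.

Let LE k : L k ^+ p = Ex (fun w => S k w ^+ p).
Proof. by rewrite /L Ln_exp//; apply: eq_Rintegral => w _; rewrite norm_even_expr. Qed.

Let double_step j : L (j + j) ^+ p <= 2 * L j ^+ p + 2 * p%:R * (L j ^+ h.*2.+3 * u j)
  + 2 * 2 ^+ p * (L j ^+ h.*2.+2 * v j).
Proof.
have mix a b : (a + b)%N = p -> Int (fun w => S j w ^+ a * I j j w ^+ b).
  by move=> ab; apply: inL_mix; rewrite ab.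
have i1 := mix p 0%N (addn0 _); have i2 := mix 0%N p (add0n _).
have i3 : Int (fun w => S j w ^+ h.*2.+3 * I j j w) := mix _ 1%N (addn1 _).
have i4 : Int (fun w => S j w * I j j w ^+ h.*2.+3) := mix 1%N _ (add1n _).
have i5 := mix h.*2.+2 2 (addn2 _); have i6 := mix 2 h.*2.+2 (add2n _).
have iS : Int (fun w => S j w ^+ p) by have := i1; under eq_fun do rewrite expr0 mulr1.
have iI : Int (fun w => I j j w ^+ p) by have := i2; under eq_fun do rewrite expr0 mul1r.
have eI : Ex (fun w => I j j w ^+ p) = L j ^+ p.
  rewrite /L -(SE j j) Ln_exp//; apply: eq_Rintegral => w _.
  by rewrite norm_even_expr.
rewrite (LE (j + j)).
pose Z w := S j w ^+ p + I j j w ^+ p + p%:R * (S j w ^+ h.*2.+3 * I j j w)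
  + p%:R * (S j w * I j j w ^+ h.*2.+3)
  + 2 ^+ p * (S j w ^+ h.*2.+2 * I j j w ^+ 2 + S j w ^+ 2 * I j j w ^+ h.*2.+2).
have iZ : Int Z.
  by apply: IntD; [apply: IntD; [apply: IntD; [apply: IntD|apply: IntZ]|apply: IntZ]
    |apply: IntZ; apply: IntD].
apply: (@le_trans _ _ (Ex Z)).
  apply: Ex_le => //; first by apply: inL_Int_exp (SL _).
  move=> w; rewrite (_ : S (j + j)%N w = S j w + I j j w); last by rewrite /I addrC subrK.
  by apply: exprD_even_le; rewrite odd_double.
rewrite /Z ExD; [|by do ?[apply: IntD|apply: IntZ]..].
rewrite ExD; [|by do ?[apply: IntD|apply: IntZ]..].
rewrite ExD; [|by do ?[apply: IntD|apply: IntZ]..].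
rewrite ExD// !ExZ//; last exact: IntD.
rewrite ExD// eI -(LE j) (rev1 j) (rev2 j).
have c1 : p%:R * Ex (fun w => S j w ^+ h.*2.+3 * I j j w) <= p%:R * (L j ^+ h.*2.+3 * u j).
  by rewrite ler_wpM2l.
have c2 : 2 ^+ p * Ex (fun w => S j w ^+ h.*2.+2 * I j j w ^+ 2) <= 2 ^+ p * (L j ^+ h.*2.+2 * v j).
  by rewrite ler_wpM2l// exprn_ge0.
move: c1 c2; rewrite mulrDr; move: (_ * Ex _) (_ * Ex _) => a b.
move: (L j ^+ p) (2 ^+ p : R) (_ * u j) (_ * v j) (p%:R : R) => x y z t c; lra.
Qed.


(** The scale 2^(N/p): dividing norms by it absorbs the factor 2 of [double_step], and it is also
    the price in L^p of a maximum over 2^N variables. *)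
Let rt N : R := (2 ^ N)%:R `^ (1 / p%:R).

Let rt_gt0 N : 0 < rt N. Proof. by rewrite powR_gt0// ltr0n expn_gt0. Qed.

Let rt_exp N : rt N ^+ p = (2 ^ N)%:R.
Proof.
rewrite -powR_mulrn ?powR_ge0// /rt -powRrM div1r mulVf ?pnatr_eq0//.
by rewrite powRr1// ler0n.
Qed.

Let rtD i j : rt (i + j) = rt i * rt j.
Proof. by rewrite /rt expnD natrM powRM. Qed.

Let Mx k n := running_max (fun i w => `|S (k + i.+1) w - S k w|) n.

Let Mx_inL k n : inL P p (Mx k n).
Proof.
apply: inL_running_max => [i|i w]; last exact: normr_ge0.
by apply: inL_norm; exact: (IL k i.+1).
Qed.

Section max_dyadic.
Variable N : nat.

Let Z l := running_max (fun j w => `|D (j * 2 ^ l) (2 ^ l) w|) (2 ^ (N - l)).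

Let Z_ge0 l w : 0 <= Z l w. Proof. exact: running_max_ge0. Qed.

Let Z_inL l : inL P p (Z l).
Proof.
by apply: inL_running_max => [i|i w]; [apply: inL_norm; exact: DL|exact: normr_ge0].
Qed.

(** The p-th power of the maximum is at most the sum of the 2^(N-l) p-th powers, all of the same
    expectation. *)
Let Z_Ln l : Ln P p (Z l) <= rt (N - l) * u (2 ^ l).
Proof.
apply: Ln_le => //; first by rewrite mulr_ge0 ?Ln_ge0// ltW.
have Zi : Int (fun w => `|Z l w| ^+ p) by case: (Z_inL l).
have Di j : Int (fun w => `|D (j * 2 ^ l) (2 ^ l) w| ^+ p) by case: (DL (j * 2 ^ l) (2 ^ l)).
apply: (@le_trans _ _ (Ex (fun w => \sum_(j < 2 ^ (N - l)) `|D (j * 2 ^ l) (2 ^ l) w| ^+ p))).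
  apply: Ex_le => //; first by apply: Int_sum => j _.
  move=> w; rewrite ger0_norm//.
  exact: (@running_max_exp_le _ _ R h.*2.+3 (fun j w => `|D (j * 2 ^ l) (2 ^ l) w|)).
rewrite Ex_sum// exprMn rt_exp.
rewrite (eq_bigr (fun=> u (2 ^ l) ^+ p)) => [|j _]; last by rewrite -(DE (j * 2 ^ l)) Ln_exp.
by rewrite sumr_const card_ord mulr_natl.
Qed.

(* [c i l * 2 ^ l] is [i.+1] rounded up to a multiple of [2 ^ l]. *)
Let c i l := iter l uphalf i.+1.

Let c_gt0 i l : (0 < c i l)%N.
Proof. by elim: l => // l IH; rewrite /c/= -/(c i l) uphalf_half; move: (c i l) IH => k; lia. Qed.

Let c_le i l : (i < 2 ^ N)%N -> (l <= N)%N -> (c i l <= 2 ^ (N - l))%N.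
Proof.
move=> iN; elim: l => [|l IH] lN; first by rewrite subn0.
rewrite /c/= -/(c i l); have := IH (ltnW lN).
have -> : (N - l = (N - l.+1).+1)%N by lia.
rewrite expnS uphalf_half; move: (2 ^ _)%N (c i l) => a b; lia.
Qed.

Let t i l := (c i l * 2 ^ l)%N.

(** Passing to the next level moves the time only when [c i l] is odd, and then by exactly one block
    of length 2^l. *)
Let tS i l : t i l.+1 = (t i l + odd (c i l) * 2 ^ l)%N.
Proof.
rewrite /t /c/= -/(c i l) expnS -mulnDl mulnCA mulnA; congr (_ * _)%N.
by rewrite uphalf_half; move: (c i l) => k; lia.
Qed.

Let t_ge i l : (i.+1 <= t i l)%N.
Proof.
elim: l => [|l IH]; first by rewrite /t /c /= muln1.
by rewrite tS (leq_trans IH)// leq_addr.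
Qed.

Let chain i K Y : (i < 2 ^ N)%N -> Fm (F i.+1) Y -> (forall w, `|Y w| <= K) -> forall l, (l <= N)%N ->
  Ex (fun w => Y w * S i.+1 w) <=
  Ex (fun w => Y w * S (t i l) w) + \sum_(j < l) Ex (fun w => `|Y w| * Z j w).
Proof.
move=> iN mY YK; have mYT := Fm_meas (@Fmeas i.+1) mY.
have SI k : Int (S k) by exact: inL_Int (SL k).
have ZI l : Int (Z l) by exact: inL_Int (Z_inL l).
elim=> [|l IH] lN; first by rewrite big_ord0 addr0 /t /c /= muln1.
apply: (le_trans (IH (ltnW lN))); rewrite big_ord_recr/= addrA [leRHS]addrAC lerD2r.
have aYK w : `|(`|Y w|)| <= K by rewrite normr_id.
have mYa : measurable_fun setT (fun w => `|Y w|) by exact: measurableT_comp.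
have [oc|ec] := boolP (odd (c i l)); last first.
  have -> : t i l.+1 = t i l by rewrite tS (negbTE ec) mul0n addn0.
  by rewrite lerDl Ex_ge0// => w; rewrite mulr_ge0.
have tE : t i l.+1 = (t i l + 2 ^ l)%N by rewrite tS oc mul1n.
(* The increment is subtracted from the later sum, hence the test function [- Y]; rounding up gives
   [t i l >= i.+1], so it is measurable with respect to the past of [t i l]. *)
have mY' : Fm (F (t i l)) (fun w => - Y w).
  by apply: (Fm_mono (Fmono (t_ge i l))); exact: measurableT_comp.
have YK' w : `|- Y w| <= K by rewrite normrN.
have mYT' : measurable_fun setT (fun w => - Y w) by exact: measurableT_comp.
have -> : Ex (fun w => Y w * S (t i l) w) =
    Ex (fun w => Y w * S (t i l.+1) w + - Y w * I (t i l) (2 ^ l) w).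
  by apply: eq_Rintegral => w _; rewrite /I -tE; ring.
rewrite ExD; [|exact: Int_mulB YK (SI _)|exact: Int_mulB YK' (II _ _)].
rewrite lerD2l (condexp_testB (sF (t i l)) (@Fmeas (t i l)) (DP (t i l) (2 ^ l)) (II _ _) mY' YK').
apply: (le_trans (Ex_test_le mYT' YK' (DI _ _))).
apply: Ex_le.
- have := integrable_norm (Int_mulB mYT' YK' (DI (t i l) (2 ^ l))).
  by apply: eq_integrable => // w _; rewrite /= normrM.
- exact: Int_mulB aYK (ZI l).
- move=> w; rewrite normrN ler_wpM2l//.
  (* [c i l] is odd while 2^(N-l) is even because [l < N]; so the block starting at [t i l] is among
     those whose maximum is [Z l]. *)
  have cl : (c i l < 2 ^ (N - l))%N.
    rewrite ltn_neqAle c_le ?(ltnW lN)// andbT; apply/eqP => e.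
    by move: oc; rewrite e -(subnSK lN) expnS oddM.
  exact: (@le_running_max _ _ R (fun j w => `|D (j * 2 ^ l) (2 ^ l) w|) _ (c i l)).
Qed.

Let t_end i : (i < 2 ^ N)%N -> t i N = (2 ^ N)%N.
Proof.
move=> iN; have := c_le iN (leqnn N); have := c_gt0 i N; rewrite subnn expn0 /t.
by case: (c i N) => [|[|]]//; rewrite mul1n.
Qed.

Lemma max_dyadic : Ln P p (Mx 0 (2 ^ N)) <=
  2 * (L (2 ^ N) + \sum_(l < N) rt (N - l) * u (2 ^ l)).
Proof.
pose W j : T -> R := if j is l.+1 then Z l else fun w => `|S (2 ^ N) w|.
(* Index [i] of the running maximum stands for time [i.+1], hence the shifted filtration. [W 0] is
   the terminal value, [W l.+1] the maximum [Z l]. *)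
have [|||||||_ H] := @weak_doob _ T R P h.*2.+2 (2 ^ N) N.+1 (fun i => F i.+1)
    (fun i w => `|S i.+1 w|) W.
- by move=> i; exact: Fmeas.
- by move=> i j ij; exact: Fmono.
- by move=> i; exact: (Fm_norm (@SF i.+1)).
- by move=> i; apply: integrable_norm; exact: inL_Int (SL i.+1).
- by move=> [|l] w; [exact: normr_ge0|exact: Z_ge0].
- by move=> [|l]; [apply: inL_norm; exact: SL|exact: Z_inL].
- move=> i iN K Y mY YK.
  have Y0 w : 0 <= Y w by case/andP: (YK w).
  pose Y' w := if 0 <= S i.+1 w then Y w else - Y w.
  have nY w : `|Y' w| = Y w by rewrite /Y'; case: ifP => _; rewrite ?normrN ger0_norm.
  have nK w : `|Y' w| <= K by rewrite nY; case/andP: (YK w).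
  have mY' : Fm (F i.+1) Y' by apply: Fm_flip => //; exact: SF.
  have mYT := Fm_meas (@Fmeas i.+1) mY'.
  have := chain iN mY' nK (leqnn N); rewrite (t_end iN).
  have -> : Ex (fun w => Y' w * S i.+1 w) = Ex (fun w => Y w * `|S i.+1 w|).
    apply: eq_Rintegral => w _; rewrite /Y'; case: ifP => [h0|/negbT]; first by rewrite ger0_norm.
    by rewrite -ltNge => /ltr0_norm ->; rewrite mulNr mulrN.
  move=> /le_trans; apply; rewrite big_ord_recl; apply: lerD.
    apply: (le_trans (Ex_test_le mYT nK (inL_Int _ (SL (2 ^ N))))) => //.
    rewrite le_eqVlt; apply/orP; left; apply/eqP.
    by apply: eq_Rintegral => w _; rewrite nY.
  rewrite le_eqVlt; apply/orP; left; apply/eqP.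
  by apply: eq_bigr => j _; apply: eq_Rintegral => w _; rewrite nY.
- have -> : Ln P p (Mx 0 (2 ^ N)) = Ln P p (running_max (fun i w => `|S i.+1 w|) (2 ^ N)).
    rewrite /Mx; congr (Ln P p (running_max _ _)).
    by apply/funext => i; apply/funext => w; rewrite add0n S0 subr0.
  apply: (le_trans H); rewrite ler_wpM2l// big_ord_recl; apply: lerD.
    by rewrite /W (Ln_norm _ _ (S (2 ^ N))).
  by apply: ler_sum => j _; exact: Z_Ln.
Qed.

End max_dyadic.

Hypothesis ME : forall k n, Ln P p (Mx k n) = Ln P p (Mx 0 n).

(** The window of length 2^N ending at [n] starts at some [k <= 2 ^ N], so it and the window
    starting at 0 cover all times up to [n], and |S_k| is itself controlled by the first one. By
    [ME] both maxima have the same norm. *)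
Let max_general n N : (2 ^ N <= n < 2 ^ N.+1)%N ->
  Ln P p (Mx 0 n) ^+ p <= 2 * 2 ^+ p * Ln P p (Mx 0 (2 ^ N)) ^+ p.
Proof.
move=> /andP[Nn nN]; pose k := (n - 2 ^ N)%N.
have kN : (k <= 2 ^ N)%N by move: nN; rewrite expnS /k; lia.
have le w : Mx 0 n w <= Mx 0 (2 ^ N) w + Mx k (2 ^ N) w.
  apply: running_max_le; first by rewrite addr_ge0 ?running_max_ge0.
  have lo i : (i < 2 ^ N)%N -> `|S (0 + i.+1) w - S 0 w| <= Mx 0 (2 ^ N) w.
    exact: (@le_running_max _ _ R (fun i w => `|S (0 + i.+1) w - S 0 w|)).
  have hi i : (i < 2 ^ N)%N -> `|S (k + i.+1) w - S k w| <= Mx k (2 ^ N) w.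
    exact: (@le_running_max _ _ R (fun i w => `|S (k + i.+1) w - S k w|)).
  move=> i ni; have [iN|Ni] := ltnP i (2 ^ N).
    by rewrite (le_trans (lo i iN))// lerDl running_max_ge0.
  have [j jN ->] : exists2 j, (j < 2 ^ N)%N & (i = k + j)%N.
    by exists (i - k)%N; rewrite /k; move: ni Ni Nn; lia.
  rewrite add0n -addnS -[S _ w - _](subrKA (S k w)) addrC; apply: le_trans (ler_normD _ _) _.
  apply: lerD (hi j jN).
  (* The maximum runs over times from 1 on, so [k = 0] is separate; there the increment vanishes. *)
  case ek : k => [|k']; first by rewrite subrr normr0 running_max_ge0.
  by have := lo k'; rewrite add0n; apply; rewrite -ek.
rewrite !Ln_exp//; apply: (@le_trans _ _ (Ex (fun w =>
  2 ^+ p * (`|Mx 0 (2 ^ N) w| ^+ p + `|Mx k (2 ^ N) w| ^+ p)))).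
  have i1 := proj2 (Mx_inL 0 (2 ^ N)); have i2 := proj2 (Mx_inL k (2 ^ N)).
  apply: Ex_le; [exact: (proj2 (Mx_inL 0 n))|by apply: IntZ; exact: IntD|move=> w].
  apply: le_trans (normD_expr_le _ _ _); rewrite lerXn2r ?nnegrE//.
  by rewrite !ger0_norm ?addr_ge0 ?running_max_ge0.
have i1 := proj2 (Mx_inL 0 (2 ^ N)); have i2 := proj2 (Mx_inL k (2 ^ N)).
rewrite ExZ; last exact: IntD.
rewrite ExD// -(Ln_exp _ (Mx k (2 ^ N)))// ME Ln_exp//.
by move: (Ex _) (2 ^+ p : R) => a b; lra.
Qed.


(** [double_step] divided by 2^(r+1): of the p factors [rt r] in 2^r, one goes to [u] or two go to
    [v], and the others to [L]. *)
Let dyadic_recursion r :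
  (L (2 ^ r.+1) / rt r.+1) ^+ p <= (L (2 ^ r) / rt r) ^+ p
   + p%:R * ((L (2 ^ r) / rt r) ^+ h.*2.+3 * (u (2 ^ r) / rt r))
   + 2 ^+ p * ((L (2 ^ r) / rt r) ^+ h.*2.+2 * (v (2 ^ r) / rt r ^+ 2)).
Proof.
have x0 : 0 < rt r ^+ p by rewrite exprn_gt0.
have e1 (a b : R) : (a / rt r) ^+ h.*2.+3 * (b / rt r) = a ^+ h.*2.+3 * b / rt r ^+ p.
  by rewrite expr_div_n mulf_div -exprSr.
have e2 (a b : R) : (a / rt r) ^+ h.*2.+2 * (b / rt r ^+ 2) = a ^+ h.*2.+2 * b / rt r ^+ p.
  by rewrite expr_div_n mulf_div -exprD addn2.
rewrite e1 e2 !expr_div_n (rt_exp r.+1) expnS natrM -(rt_exp r) mul2n -addnn.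
exact: div_double_le (double_step _).
Qed.

Let Hu n := \sum_(1 <= k < n.+1) (k%:R `^ (1 + 1 / p%:R))^-1 * u k.
Let Hv n := \sum_(1 <= k < n.+1) (k%:R `^ (1 + 2 / p%:R))^-1 * v k.

(** [2 * 2 ^+ p] pays for general [n] in [max_general], and [2 ^+ p * 2 ^+ p] for the 2 of
    [max_dyadic] and for splitting a p-th power of a sum. The 3's come from [root_split], [p%:R] and
    the inner [2 ^+ p] from [dyadic_recursion]. 17 and 33 are [1 + 8 * c] for the subadditivity
    constants 2 and 4; the lone [17 ^+ p] belongs to the increments in the maximum. *)
Definition moment_const : R :=
  2 * 2 ^+ p * (2 ^+ p * 2 ^+ p) * (3 + (3 * p%:R * 17) ^+ p + 17 ^+ p + (3 * 2 ^+ p * 33) ^+ m).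

Lemma moment_max_bound n : (0 < n)%N ->
  Ln P p (Mx 0 n) ^+ p <=
  moment_const * n%:R * (L 1 ^+ p + Hu n ^+ p + Hv n ^+ m).
Proof.
move=> n0; pose N := trunc_log 2 n.
have nb : (2 ^ N <= n < 2 ^ N.+1)%N by apply: trunc_log_bounds.
apply: (le_trans (max_general nb)).
have /andP[Nn _] := nb.
have u0 k : 0 <= u k by exact: Ln_ge0.
have v0 k : 0 <= v k by exact: Ln_ge0.
pose A r := L (2 ^ r) / rt r; pose U r := u (2 ^ r) / rt r.
pose W r := v (2 ^ r) / rt r ^+ 2.
have A0 r : 0 <= A r by rewrite divr_ge0 ?Ln_ge0// ltW.
have U0 r : 0 <= U r by rewrite divr_ge0// ltW.
have W0 r : 0 <= W r by rewrite divr_ge0 ?exprn_ge0// ltW.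
have AN := @recursion_bound R h.+1 A U W p%:R (2 ^+ p) N A0 U0 W0 (ler0n _ _)
  (exprn_ge0 _ (ler0n _ 2)) (fun r _ => dyadic_recursion r).
have trunc_sum (f : nat -> R) : (forall k, 0 <= f k) ->
    \sum_(1 <= k < 2 ^ N) f k <= \sum_(1 <= k < n.+1) f k.
  move=> f0; rewrite [leRHS](big_cat_nat (n := 2 ^ N))//=; last 2 first.
  - by rewrite expn_gt0.
  - exact: leqW.
  by rewrite lerDl sumr_ge0.
have UH : \sum_(r < N) U r <= 17 * Hu n.
  have := @dyadic_sum_le R u 2 (1 / p%:R) u0 (ler0n _ _) (divr_ge0 ler01 (ler0n _ _))
    (fun i j _ _ => u_sub i j) N.
  rewrite (_ : 1 + 8 * 2 = 17 :> R); last by ring.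
  move=> /le_trans; apply; rewrite ler_wpM2l// trunc_sum// => k.
  by rewrite mulr_ge0// invr_ge0 powR_ge0.
have WH : \sum_(r < N) W r <= 33 * Hv n.
  have := @dyadic_sum_le R v 4 (2 / p%:R) v0 (ler0n _ _) (divr_ge0 (ler0n _ _) (ler0n _ _))
    (fun i j _ _ => v_sub i j) N.
  rewrite (_ : 1 + 8 * 4 = 33 :> R); last by ring.
  rewrite [X in X <= _](_ : _ = \sum_(r < N) W r); last first.
    apply: eq_bigr => r _; rewrite /W /rt -powR_mulrn ?powR_ge0// -powRrM.
    by rewrite mulrAC mul1r.
  move=> /le_trans; apply; rewrite ler_wpM2l// trunc_sum// => k.
  by rewrite mulr_ge0// invr_ge0 powR_ge0.
have MN : Ln P p (Mx 0 (2 ^ N)) <= 2 * (rt N * (A N + \sum_(r < N) U r)).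
  apply: (le_trans (max_dyadic N)); rewrite ler_wpM2l// mulrDr; apply: lerD.
    by rewrite /A mulrCA divff ?mulr1// gt_eqF.
  rewrite mulr_sumr; apply: ler_sum => l _.
  have -> : rt N = rt (N - l) * rt l by rewrite -rtD subnK// ltnW.
  by rewrite /U -mulrA [rt l * _]mulrCA divff ?mulr1// gt_eqF.
have HU0 : 0 <= Hu n.
  by apply: sumr_ge0 => k _; rewrite mulr_ge0// invr_ge0 powR_ge0.
have HV0 : 0 <= Hv n.
  by apply: sumr_ge0 => k _; rewrite mulr_ge0// invr_ge0 powR_ge0.
have sU0 : 0 <= \sum_(r < N) U r by apply: sumr_ge0.
have sW0 : 0 <= \sum_(r < N) W r by apply: sumr_ge0.
have A0E : A 0%N ^+ p = L 1 ^+ p.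
  by rewrite /A /rt expn0 powR1 divr1.
have e2p : 0 <= 2 ^+ p :> R by exact: exprn_ge0.
have K1 : A N ^+ p <= 3 * L 1 ^+ p + (3 * p%:R * 17) ^+ p * Hu n ^+ p
    + (3 * 2 ^+ p * 33) ^+ m * Hv n ^+ m.
  rewrite -A0E -!exprMn; apply: (le_trans AN); apply: lerD; first apply: lerD => //.
    rewrite lerXn2r ?nnegrE ?mulr_ge0//.
    by rewrite mulrA -[leRHS]mulrA ler_wpM2l// mulr_ge0.
  have a1 : 0 <= 3 * 2 ^+ p :> R by exact: mulr_ge0.
  have a2 : 3 * (2 ^+ p * \sum_(r < N) W r) <= 3 * 2 ^+ p * 33 * Hv n.
    by rewrite mulrA -[leRHS]mulrA ler_wpM2l.
  have a3 : 0 <= 3 * (2 ^+ p * \sum_(r < N) W r) by rewrite mulrA; exact: mulr_ge0.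
  by rewrite lerXn2r ?nnegrE// (le_trans a3).
have K2 : (\sum_(r < N) U r) ^+ p <= 17 ^+ p * Hu n ^+ p.
  by rewrite -exprMn lerXn2r ?nnegrE ?mulr_ge0.
have K3 : Ln P p (Mx 0 (2 ^ N)) ^+ p <=
    2 ^+ p * 2 ^+ p * n%:R * (A N ^+ p + (\sum_(r < N) U r) ^+ p).
  apply: (@le_trans _ _ ((2 * (rt N * (A N + \sum_(r < N) U r))) ^+ p)).
    by rewrite lerXn2r ?nnegrE ?Ln_ge0 ?mulr_ge0 ?addr_ge0// ltW.
  have G1 := normD_expr_le p (A N) (\sum_(r < N) U r).
  rewrite !ger0_norm ?addr_ge0// in G1.
  have nN : (2 ^ N)%:R <= n%:R :> R by rewrite ler_nat.
  have G0 : 0 <= (A N + \sum_(r < N) U r) ^+ p by rewrite exprn_ge0 ?addr_ge0.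
  have N0 : 0 <= (2 ^ N)%:R :> R by rewrite ler0n.
  rewrite [(2 * _) ^+ p]exprMn [(rt N * _) ^+ p]exprMn rt_exp.
  move: (A N ^+ p + _ ^+ p) ((_ + _) ^+ p) (2 ^+ p) e2p G1 nN G0 N0.
  move=> X G a a0 G1 nN G0 N0; rewrite -!mulrA ler_wpM2l// [leRHS]mulrCA.
  exact: ler_pM.
have hu0 : 0 <= Hu n ^+ p by rewrite exprn_ge0.
have hv0 : 0 <= Hv n ^+ m by rewrite exprn_ge0.
have l0 : 0 <= L 1 ^+ p by rewrite exprn_ge0// Ln_ge0.
have q1 : 0 <= (3 * p%:R * 17) ^+ p :> R by rewrite exprn_ge0 ?mulr_ge0.
have q2 : 0 <= 17 ^+ p :> R by rewrite exprn_ge0.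
have q3 : 0 <= (3 * 2 ^+ p * 33) ^+ m :> R by apply: exprn_ge0; apply: mulr_ge0 => //; exact: mulr_ge0.
have K4 : A N ^+ p + (\sum_(r < N) U r) ^+ p <=
    (3 + (3 * p%:R * 17) ^+ p + 17 ^+ p + (3 * 2 ^+ p * 33) ^+ m) *
    (L 1 ^+ p + Hu n ^+ p + Hv n ^+ m).
  exact: combine_le.
rewrite /moment_const; move: (_ + _ + _ + _) (L 1 ^+ p + _ + _) K3 K4 => c s K3 K4.
have -> : 2 * 2 ^+ p * (2 ^+ p * 2 ^+ p) * c * n%:R * s =
    2 * 2 ^+ p * (2 ^+ p * 2 ^+ p * n%:R * (c * s)).
  by move: (2 ^+ p : R) (n%:R : R) => e k; ring.
apply: ler_wpM2l; first exact: mulr_ge0.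
apply: (le_trans K3); apply: ler_wpM2l => //.
Qed.

End partial_sums.

Lemma moment_const_ge0 (R : realType) h : 0 <= moment_const R h.
Proof.
have e2 k : 0 <= 2 ^+ k :> R by exact: exprn_ge0.
rewrite /moment_const; apply: mulr_ge0; first by apply: mulr_ge0; exact: mulr_ge0.
apply: addr_ge0; last by apply: exprn_ge0; apply: mulr_ge0 => //; exact: mulr_ge0.
apply: addr_ge0; last exact: exprn_ge0.
by apply: addr_ge0 => //; apply: exprn_ge0; apply: mulr_ge0 => //; exact: mulr_ge0.
Qed.

(** * Equality in law and the Markov property *)

Section bounded_convergence.
Context d (T : measurableType d) (R : realType) (mu : {measure set T -> \bar R}).
Hypothesis muT : (mu setT < +oo)%E.

Lemma bounded_integrable K (X : T -> R) : measurable_fun setT X ->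
  (forall w, `|X w| <= K) -> mu.-integrable setT (EFin \o X).
Proof.
move=> mX XK; apply: measurable_bounded_integrable => //.
exists K; split; first exact: num_real.
by move=> x Kx w _; exact: le_trans (XK w) (ltW Kx).
Qed.

Lemma bounded_convergence K (X : nat -> T -> R) (Y : T -> R) :
  (forall n, measurable_fun setT (X n)) -> (forall n w, `|X n w| <= K) ->
  measurable_fun setT Y -> (forall w, X ^~ w @ \oo --> Y w) ->
  (fun n => Rintegral mu setT (X n)) @ \oo --> Rintegral mu setT Y.
Proof.
move=> mX XK mY XY.
have mF n : measurable_fun setT (EFin \o X n) by exact/measurable_EFinP.
have mL : measurable_fun setT (EFin \o Y) by exact/measurable_EFinP.
have cF : {ae mu, forall w, setT w -> (EFin \o X n) w @[n --> \oo] --> (EFin \o Y) w}.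
  by apply: aeW => w _; apply/fine_cvgP; split; [exact: nearW|exact: XY].
have iK : mu.-integrable setT (EFin \o cst K) by exact: (@bounded_integrable `|K|).
have dF : {ae mu, forall w n, setT w -> (`|(EFin \o X n) w| <= (EFin \o cst K) w)%E}.
  by apply: aeW => w n _; rewrite /= lee_fin XK.
have [iY _ h] := dominated_convergence measurableT mF mL cF iK dF.
have fY : (\int[mu]_x (EFin \o Y) x)%E \is a fin_num by exact: integrable_fin_num.
by move: h; rewrite -(fineK fY) => /fine_cvgP[].
Qed.

End bounded_convergence.

Section equal_laws.
Context d d' (T : measurableType d) (T' : measurableType d') (R : realType)
  (P : probability T R).
Local Notation Ex X := (Rintegral P setT X).
Implicit Types (X Y : {RV P >-> T'}) (C : set T').

(** Positive and negative parts are transported separately, so that integrability of [G] can itself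
    be read off from the identity. *)
Lemma integral_distributionE X C (G : T' -> R) : measurable C -> measurable_fun setT G ->
  (\int[distribution P X]_(y in C) (G y)%:E = \int[P]_(w in X @^-1` C) (G (X w))%:E)%E.
Proof.
move=> mC mG; have mX : measurable_fun setT X by exact: measurable_funP.
have mE : measurable_fun C (EFin \o G) by apply/measurable_EFinP; exact: measurable_funTS.
rewrite integralE [RHS]integralE; congr (_ - _)%E.
- rewrite ge0_integral_pushforward//; last exact: measurable_funepos.
  by apply: eq_integral => w _; rewrite /= !funeposE.
- rewrite ge0_integral_pushforward//; last exact: measurable_funeneg.
  by apply: eq_integral => w _; rewrite /= !funenegE.
Qed.

Definition eq_law X Y := forall C, measurable C -> P (X @^-1` C) = P (Y @^-1` C).

Section eq_law.
Variables X Y : {RV P >-> T'}.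
Hypothesis XY : eq_law X Y.

Lemma eq_law_integral C (G : T' -> R) : measurable C -> measurable_fun setT G ->
  (\int[P]_(w in X @^-1` C) (G (X w))%:E = \int[P]_(w in Y @^-1` C) (G (Y w))%:E)%E.
Proof.
move=> mC mG; rewrite -!integral_distributionE//; apply: eq_measure_integral => A mA _.
exact: XY.
Qed.

Lemma eq_law_Ex (G : T' -> R) : measurable_fun setT G ->
  Ex (fun w => G (X w)) = Ex (fun w => G (Y w)).
Proof.
by move=> mG; have := eq_law_integral measurableT mG; rewrite !preimage_setT /Rintegral => ->.
Qed.

Lemma eq_law_integrable (G : T' -> R) : measurable_fun setT G ->
  P.-integrable setT (EFin \o (fun w => G (X w))) ->
  P.-integrable setT (EFin \o (fun w => G (Y w))).
Proof.
move=> mG /integrableP[_ h]; apply/integrableP; split.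
  by apply/measurable_EFinP; apply: measurableT_comp => //; exact: measurable_funP.
have mG' : measurable_fun setT (fun x => `|G x|) by exact: measurableT_comp.
have := eq_law_integral measurableT mG'; rewrite !preimage_setT.
by move=> <-.
Qed.

End eq_law.
End equal_laws.

Section condexp_unique.
Context d (T : measurableType d) (R : realType) (P : probability T R).
Variable G : set (set T).
Hypotheses (sG : sigma_algebra setT G) (Gm : G `<=` measurable).

(** Tested against bounded [G]-measurable functions the difference vanishes, so [Ln_dual] applies
    with an empty family of dominating variables and bounds its L^2 norm by an empty sum. *)
Lemma condexp_unique (X D1 D2 : T -> R) : P.-integrable setT (EFin \o X) ->
  is_condexp P G X D1 -> is_condexp P G X D2 -> D1 = D2 %[ae P].
Proof.
move=> iX c1 c2; have [_ i1 _] := c1; have [_ i2 _] := c2.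
have mD : Fm G (fun w => D1 w - D2 w).
  by apply: measurable_funB; [exact: (is_condexp_Fm sG c1)|exact: (is_condexp_Fm sG c2)].
have iD := IntB i1 i2.
have [L2 h] : inL P 2 (fun w => D1 w - D2 w) /\ Ln P 2 (fun w => D1 w - D2 w) <=
    2 * \sum_(j < 0) Ln P 2 (cst 0 : T -> R).
  apply: (@Ln_dual _ T R P G Gm 0 0 (fun=> cst 0)) => // [_|K Y mY YK]; first exact: inL0.
  have mYT := Fm_meas Gm mY.
  have -> : Rintegral P setT (fun w => Y w * (D1 w - D2 w)) =
      Rintegral P setT (fun w => Y w * D1 w - Y w * D2 w).
    by apply: eq_Rintegral => w _; rewrite mulrBr.
  rewrite ExB; [|exact: Int_mulB YK _..].
  rewrite -(condexp_testB sG Gm c1 iX mY YK) -(condexp_testB sG Gm c2 iX mY YK).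
  by rewrite subrr big_ord0.
rewrite big_ord0 mulr0 in h.
have h0 : Ln P 2 (fun w => D1 w - D2 w) = 0 by apply/eqP; rewrite eq_le h Ln_ge0.
have e0 : Rintegral P setT (fun w => `|D1 w - D2 w| ^+ 2) = 0.
  by rewrite -(Ln_exp P (fun w => D1 w - D2 w) (ltn0Sn 1)) h0 expr0n.
have [mD12 iD2] := L2.
have := (@ae_eq_integral_abs _ T R P setT measurableT
  (fun w => (`|D1 w - D2 w| ^+ 2)%:E) (measurable_int P iD2)).1.
rewrite (eq_integral (fun w => (`|D1 w - D2 w| ^+ 2)%:E)); last first.
  by move=> w _; rewrite gee0_abs// lee_fin exprn_ge0.
rewrite Ex_EFin// e0 => /(_ erefl); apply: filterS => w /= hw wT.
have := hw wT => -[] /eqP; rewrite expf_eq0/= normr_eq0 subr_eq0 => /eqP.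
by [].
Qed.

End condexp_unique.

(** * The kernel operator on functions with values in [0,1] *)

Section kernel_op_theory.
Context dE (E : measurableType dE) (R : realType) (Q : R.-pker E ~> E).
Implicit Types h : E -> R.

Let Q1 x : Q x setT = 1%E. Proof. exact: prob_kernel. Qed.

Let QT x : (Q x setT < +oo)%E. Proof. by rewrite Q1 ltry. Qed.

(** This class is stable under the kernel operator and under multiplication by indicators, and
    bounded convergence applies to it. *)
Definition unit_fun h := measurable_fun setT h /\ forall x, 0 <= h x <= 1.

Lemma unit_fun_norm h x : unit_fun h -> `|h x| <= 1.
Proof. by move=> [_ /(_ x)/andP[h0 h1]]; rewrite ger0_norm. Qed.

Let unit_int h x : unit_fun h -> (Q x).-integrable setT (EFin \o h).
Proof.
move=> hu; apply: (bounded_integrable (QT x) (K := 1)); first by case: hu.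
by move=> y; exact: unit_fun_norm.
Qed.

Lemma kernel_op_unit h : unit_fun h -> unit_fun (kernel_op Q h).
Proof.
move=> hu; have [mh h01] := hu; split.
  rewrite /kernel_op /Rintegral; apply: measurableT_comp => //.
  apply: (@measurable_fun_integral_kernel _ _ E E R (fun x => Q x)) => //.
  - by move=> U mU; exact: measurable_kernel.
  - by move=> z; rewrite lee_fin; case/andP: (h01 z).
  - exact/measurable_EFinP.
move=> x; rewrite /kernel_op; apply/andP; split.
  by apply: Rintegral_ge0 => y _; case/andP: (h01 y).
have i1 : (Q x).-integrable setT (EFin \o cst 1) by apply: (bounded_integrable (QT x) (K := 1)) => // w; rewrite normr1.
apply: (@le_trans _ _ (Rintegral (Q x) setT (cst 1))).
  by apply: le_Rintegral => //; [exact: unit_int|move=> y _; case/andP: (h01 y)].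
by rewrite Rintegral_cst// mul1r Q1.
Qed.

Lemma kernel_op_cst1 x : kernel_op Q (cst 1) x = 1.
Proof. by rewrite /kernel_op Rintegral_cst// mul1r Q1. Qed.

Lemma unit_fun_cst1 : unit_fun (cst 1).
Proof. by split => // x; rewrite ler01 lexx. Qed.

Lemma unit_fun_indicM A h : measurable A -> unit_fun h -> unit_fun (fun x => \1_A x * h x).
Proof.
move=> mA [mh h01]; split; first by apply: measurable_funM => //; exact: measurable_indic.
move=> x; have /andP[h0 h1] := h01 x; rewrite indicE.
by case: (x \in A); rewrite ?mul1r ?mul0r ?h0 ?h1 ?lexx ?ler01.
Qed.

Import HBNNSimple.

Lemma kernel_op_extend d (T : measurableType d) (P : probability T R) (X Y : {RV P >-> E})
    (B : set T) h : measurable B -> unit_fun h ->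
  (forall A, measurable A -> Rintegral P setT (fun w => \1_B w * \1_A (Y w)) =
                             Rintegral P setT (fun w => \1_B w * kernel_op Q \1_A (X w))) ->
  Rintegral P setT (fun w => \1_B w * h (Y w)) =
  Rintegral P setT (fun w => \1_B w * kernel_op Q h (X w)).
Proof.
move=> mB hu H; have [mh h01] := hu.
have mf : measurable_fun setT (EFin \o h) by exact/measurable_EFinP.
pose g n : E -> R := @nnsfun_approx _ E R setT measurableT _ mf n.
have f0 x : setT x -> (0 <= (EFin \o h) x)%E by rewrite lee_fin; case/andP: (h01 x).
have g0 n x : 0 <= g n x by exact: fun_ge0.
have gh n x : g n x <= h x.
  by rewrite -lee_fin /g nnsfun_approxE; exact: (le_approx n f0).
have gcv x : g ^~ x @ \oo --> h x.
  rewrite /g; under eq_fun do rewrite nnsfun_approxE.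
  by apply: (cvg_approx f0) => //; rewrite ltry.
have mg n : measurable_fun setT (g n) by exact: measurable_funP.
have gu n : unit_fun (g n).
  by split => // x; rewrite g0 (le_trans (gh n x))//; case/andP: (h01 x).
have mX : measurable_fun setT X by exact: measurable_funP.
have mY : measurable_fun setT Y by exact: measurable_funP.
have PT : (P setT < +oo)%E by rewrite probability_setT ltry.
have mB1 : measurable_fun setT (\1_B : T -> R) by exact: measurable_indic.
have B1 w : `|\1_B w : R| <= 1 by rewrite ger0_norm// indicE lern1 leq_b1.
have bnd (u : E -> R) (Z : T -> E) w : unit_fun u -> `|\1_B w * u (Z w)| <= 1.
  move=> uu; rewrite normrM -[leRHS]mulr1; apply: ler_pM => //; exact: unit_fun_norm.
have Hg n : Rintegral P setT (fun w => \1_B w * g n (Y w)) =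
    Rintegral P setT (fun w => \1_B w * kernel_op Q (g n) (X w)).
  pose r := finmap.enum_fset (fset_set (range (g n))).
  pose A y := g n @^-1` [set y].
  have mA y : measurable (A y).
    by rewrite -[A y]setTI; apply: mg => //; exact: measurable_set1.
  have gE x : g n x = \sum_(y <- r) y * \1_(A y) x.
    by rewrite {1}/g fimfunE fsbig_finite//; exact: fimfunP.
  have Iu y : unit_fun (\1_(A y)).
    split; first exact: measurable_indic.
    by move=> x; rewrite indicE ler0n lern1 leq_b1.
  have KE x : kernel_op Q (g n) x = \sum_(y <- r) y * kernel_op Q \1_(A y) x.
    rewrite /kernel_op (@eq_Rintegral _ _ R _ setT (fun s => \sum_(y <- r) y * \1_(A y) s)); last first.
      by move=> s _; rewrite gE.
    elim: r {gE} => [|y r IH].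
      rewrite big_nil (@eq_Rintegral _ _ R _ setT (cst 0)) ?Rintegral_cst ?mul0r// => s _.
      by rewrite big_nil.
    rewrite big_cons -IH -RintegralZl//; last exact: unit_int.
    rewrite -RintegralD//.
    - by apply: eq_Rintegral => s _; rewrite big_cons.
    - exact: (integrableZl measurableT y (unit_int x (Iu y))).
    - have := @integrable_sum _ E R (Q x) setT measurableT _ r xpredT
        (fun y s => (y * \1_(A y) s)%:E).
      move=> /(_ _)/eq_integrable; apply=> // [s _|z _]; first by rewrite /= sumEFin.
      exact: (integrableZl measurableT z (unit_int x (Iu z))).
  have i1 y : P.-integrable setT (EFin \o (fun w => \1_B w * \1_(A y) (Y w))).
    apply: (bounded_integrable PT (K := 1)) => [|w]; last exact: bnd.
    by apply: measurable_funM => //; apply: measurableT_comp => //; exact: measurable_indic.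
  have i2 y : P.-integrable setT (EFin \o (fun w => \1_B w * kernel_op Q \1_(A y) (X w))).
    apply: (bounded_integrable PT (K := 1)) => [|w]; last by apply: bnd; exact: kernel_op_unit.
    apply: measurable_funM => //; apply: measurableT_comp => //.
    by have [] := kernel_op_unit (Iu y).
  rewrite (@eq_Rintegral _ _ R _ setT (fun w => \sum_(y <- r) y * (\1_B w * \1_(A y) (Y w)))); last first.
    by move=> w _; rewrite gE mulr_sumr; apply: eq_bigr => y _; rewrite mulrCA.
  rewrite [RHS](@eq_Rintegral _ _ R _ setT (fun w => \sum_(y <- r) y * (\1_B w * kernel_op Q \1_(A y) (X w)))); last first.
    by move=> w _; rewrite KE mulr_sumr; apply: eq_bigr => y _; rewrite mulrCA.
  rewrite !Ex_sum => [|y|y]; [|exact: IntZ..].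
  by apply: eq_bigr => y _; rewrite !ExZ// H.
have c1 : (fun n => Rintegral P setT (fun w => \1_B w * g n (Y w))) @ \oo -->
    Rintegral P setT (fun w => \1_B w * h (Y w)).
  apply: (bounded_convergence PT (K := 1)).
  - by move=> n; apply: measurable_funM => //; exact: measurableT_comp.
  - by move=> n w; exact: bnd.
  - by apply: measurable_funM => //; exact: measurableT_comp.
  - by move=> w; apply: cvgMl_tmp; exact: gcv.
have c2 : (fun n => Rintegral P setT (fun w => \1_B w * kernel_op Q (g n) (X w))) @ \oo -->
    Rintegral P setT (fun w => \1_B w * kernel_op Q h (X w)).
  apply: (bounded_convergence PT (K := 1)).
  - move=> n; apply: measurable_funM => //; apply: measurableT_comp => //.
    by have [] := kernel_op_unit (gu n).
  - by move=> n w; apply: bnd; exact: kernel_op_unit.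
  - apply: measurable_funM => //; apply: measurableT_comp => //.
    by have [] := kernel_op_unit hu.
  (* Bounded convergence is used twice: here under [Q (X w)], for pointwise convergence of the
     images, and around it under [P]. *)
  - move=> w; apply: cvgMl_tmp; apply: (bounded_convergence (QT (X w)) (K := 1)) => //.
    by move=> n x; exact: unit_fun_norm.
move: c1; under eq_fun do rewrite Hg; move=> c1.
exact: (cvg_unique _ c1 c2).
Qed.

End kernel_op_theory.

Section chain_past.
Context d dE (T : measurableType d) (E : measurableType dE) (R : realType)
  (P : probability T R) (zeta : int -> {RV P >-> E}).

Lemma past_sigma_algebra k : sigma_algebra setT (past zeta k).
Proof. exact: smallest_sigma_algebra. Qed.

Lemma past_measurable k : past zeta k `<=` measurable.
Proof.
apply: smallest_sub; first exact: sigma_algebra_measurable.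
move=> A [i _ [B mB <-]]; rewrite setTI -[_ @^-1` _]setTI.
exact: (measurable_funP (zeta i)).
Qed.

Lemma past_mono i j : i <= j -> past zeta i `<=` past zeta j.
Proof.
move=> ij; apply: smallest_sub; first exact: past_sigma_algebra.
move=> A [l /= li hA]; apply: sub_sigma_algebra; exists l => //=.
exact: le_trans ij.
Qed.

Lemma present_past k A : measurable A -> past zeta k (zeta k @^-1` A).
Proof.
move=> mA; apply: sub_sigma_algebra; exists k => //=.
by exists A => //; rewrite setTI.
Qed.

Lemma present_sigma_algebra k : sigma_algebra setT (g_sigma_algebra_preimage (zeta k)).
Proof. exact/sigma_algebra_preimage/sigma_algebra_measurable. Qed.

Lemma present_measurable k : g_sigma_algebra_preimage (zeta k) `<=` measurable.
Proof.
move=> A [B mB <-]; exact: (measurable_funP (zeta k)).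
Qed.

End chain_past.

Section reversible_chain.
Context d dE (T : measurableType d) (E : measurableType dE) (R : realType)
  (P : probability T R) (zeta : int -> {RV P >-> E}) (Q : R.-pker E ~> E).
Hypotheses (st : stationary zeta) (mk : markov_property zeta)
  (tk : transition_kernel zeta Q).
Local Notation Ex X := (Rintegral P setT X).

Lemma stationary1 k : eq_law (zeta k) (zeta 0).
Proof.
move=> C mC; have := @st k [:: 0] (fun=> C) (fun=> mC).
rewrite (_ : \bigcap_(i in [set` [:: 0%R : int]]) (zeta (i + k) @^-1` C) = zeta k @^-1` C).
  rewrite (_ : \bigcap_(i in [set` [:: 0%R : int]]) (zeta i @^-1` C) = zeta 0 @^-1` C)//.
  apply/seteqP; split=> [w /(_ 0)|w h i /=]; last by rewrite inE => /eqP ->.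
  by apply; rewrite /= inE.
apply/seteqP; split=> [w /(_ 0)|w h i /=]; last by rewrite inE => /eqP ->; rewrite add0r.
by rewrite add0r; apply; rewrite /= inE.
Qed.

Lemma stationary2 k A B : measurable A -> measurable B ->
  P (zeta k @^-1` A `&` zeta (k + 1) @^-1` B) = P (zeta 0 @^-1` A `&` zeta 1 @^-1` B).
Proof.
move=> mA mB; pose C (i : int) := if i == 0 then A else B.
have mC i : measurable (C i) by rewrite /C; case: ifP.
have := @st k [:: 0; 1] C mC.
have e (l : int) : \bigcap_(i in [set` [:: 0; 1 : int]]) (zeta (i + l) @^-1` C i) =
    zeta l @^-1` A `&` zeta (l + 1) @^-1` B.
  apply/seteqP; split=> [w h|w [h1 h2] i /=].
    split; first by have := h 0; rewrite add0r /C eqxx; apply; rewrite /= inE.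
    by have := h 1; rewrite addrC /C; apply; rewrite /= !inE.
  by rewrite !inE => /orP[|] /eqP ->; rewrite /C /= ?add0r// addrC.
rewrite e => ->; have := e 0; rewrite add0r => <-.
by congr (P _); apply: eq_bigcapr => i _; rewrite addr0.
Qed.

Let Qm A : measurable A -> measurable_fun setT (fun x => fine (Q x A)).
Proof. by move=> mA; apply: measurableT_comp => //; exact: measurable_kernel. Qed.

Let Q01 x A : measurable A -> `|fine (Q x A)| <= 1.
Proof.
move=> mA; rewrite ger0_norm ?fine_ge0//.
have Q1 : Q x setT = 1%E by exact: prob_kernel.
have h : (Q x A <= 1)%E by rewrite -Q1 le_measure ?inE.
by rewrite -lee_fin fineK// ge0_fin_numE// (le_lt_trans h)// ltry.
Qed.

Let PT : (P setT < +oo)%E. Proof. by rewrite probability_setT ltry. Qed.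

Let Qi k A : measurable A -> P.-integrable setT (EFin \o (fun w => fine (Q (zeta k w) A))).
Proof.
move=> mA; apply: (bounded_integrable PT (K := 1)) => [|w]; last exact: Q01.
exact: (measurableT_comp (@Qm A mA) (measurable_funP (zeta k))).
Qed.

Let indi k A : measurable A -> P.-integrable setT (EFin \o (\1_(zeta k @^-1` A) : T -> R)).
Proof.
move=> mA; apply: integrable_indic => //.
by rewrite -[_ @^-1` _]setTI; exact: (measurable_funP (zeta k)).
Qed.

Let mpre k A : measurable A -> measurable (zeta k @^-1` A).
Proof. by move=> mA; rewrite -[_ @^-1` _]setTI; exact: (measurable_funP (zeta k)). Qed.

(** The kernel is specified at time 0 only; stationarity of single times moves the integral of [Q],
    and stationarity of adjacent pairs moves the joint probability, to time [k]. *)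
Let kernel_condexp k A : measurable A ->
  is_condexp P (g_sigma_algebra_preimage (zeta k)) \1_(zeta (k + 1) @^-1` A)
    (fun w => fine (Q (zeta k w) A)).
Proof.
move=> mA; split; last 1 first.
- move=> _ [B mB <-]; rewrite setTI.
  rewrite (eq_law_integral (stationary1 k) mB (Qm mA)).
  have c0 := condexpP (present_sigma_algebra zeta 0) (@present_measurable _ _ _ _ _ _ zeta 0)
    (indi 1 mA).
  have [_ i0 h0] := c0.
  have hB : g_sigma_algebra_preimage (zeta 0) (zeta 0 @^-1` B) by exists B => //; rewrite setTI.
  have := h0 _ hB.
  rewrite (@ae_eq_integral _ T R P _
    (fun w => (fine (Q (zeta 0 w) A))%:E) _ (mpre 0 mB)).
  + move=> ->; rewrite !integral_indic//; [|exact: mpre..].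
    rewrite setIC [in RHS]setIC; apply/esym.
    exact: stationary2.
  + by apply: measurable_funTS; exact: (measurable_int P i0).
  + by apply: measurable_funTS; exact: (measurable_int P (Qi 0 mA)).
  + have := tk mA; apply: filterS => w h /= _.
    by rewrite h.
- move=> B mB; exists ((fun x => fine (Q x A)) @^-1` B); last by rewrite setTI.
  by rewrite -[_ @^-1` _]setTI; exact: Qm.
- exact: Qi.
Qed.

(** The Markov property replaces the past by the present, and a.e. uniqueness replaces the chosen
    version by the kernel. *)
Lemma markov_indic k A B : measurable A -> past zeta k B ->
  Ex (fun w => \1_B w * \1_A (zeta (k + 1) w)) =
  Ex (fun w => \1_B w * kernel_op Q \1_A (zeta k w)).
Proof.
move=> mA pB; have mB := past_measurable pB.
have [mC1 i1 h1] := condexpP (past_sigma_algebra zeta k) (@past_measurable _ _ _ _ _ _ zeta k)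
  (indi (k + 1) mA).
have c2 := condexpP (present_sigma_algebra zeta k) (@present_measurable _ _ _ _ _ _ zeta k)
  (indi (k + 1) mA).
have uq := condexp_unique (present_sigma_algebra zeta k) (@present_measurable _ _ _ _ _ _ zeta k)
  (indi (k + 1) mA) c2 (kernel_condexp k mA).
have -> : Ex (fun w => \1_B w * kernel_op Q \1_A (zeta k w)) =
    Ex (fun w => \1_B w * fine (Q (zeta k w) A)).
  apply: eq_Rintegral => w _; congr (_ * _).
  by rewrite /kernel_op /Rintegral integral_indic// setIT.
rewrite !Ex_indic//; have := h1 _ pB.
rewrite (@ae_eq_integral _ T R P _ (fun w => (fine (Q (zeta k w) A))%:E) _ mB).
- by rewrite /Rintegral => ->.
- by apply: measurable_funTS; exact: (measurable_int P i1).
- by apply: measurable_funTS; exact: (measurable_int P (Qi k mA)).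
- by have := mk k mA; apply: filterS2 uq => w hu hm _ /=; rewrite hm// hu.
Qed.

Lemma markov_unit_fun k h B : unit_fun h -> past zeta k B ->
  Ex (fun w => \1_B w * h (zeta (k + 1) w)) =
  Ex (fun w => \1_B w * kernel_op Q h (zeta k w)).
Proof.
move=> hu pB; apply: kernel_op_extend => //; first exact: past_measurable pB.
by move=> A mA; exact: markov_indic.
Qed.

End reversible_chain.

(** * Reversal of the path *)

(** In a list indexed by the times from -N to N, time [i] sits at position i+N; position N-i of the
    reversed list carries the same time. *)
Lemma shift_window (i : int) (N : nat) : (absz i <= N)%N ->
  [/\ (absz (i + N%:Z)%R < N.*2.+1)%N, (absz (i + N%:Z)%R)%:Z = i + N%:Z &
   (N.*2.+1 - (absz (N%:Z - i)%R).+1)%N%:Z - N%:Z = i].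
Proof. by move=> iN; split; lia. Qed.

Section cylinders.
Context dE (E : measurableType dE) (R : realType) (Q : R.-pker E ~> E).
Implicit Types (A : set E) (l : seq (set E)).

(* [cyl_fun l x] is the probability that the chain started at [x] visits
   the sets of [l] successively. *)
Fixpoint cyl_fun l : E -> R :=
  if l is A :: l' then fun x => \1_A x * kernel_op Q (cyl_fun l') x else cst 1.

(** The default [setT] is measurable, so positions beyond the list impose nothing. *)
Definition all_measurable l := forall j, measurable (nth setT l j).

Lemma all_measurable_cons A l : measurable A -> all_measurable l -> all_measurable (A :: l).
Proof. by move=> mA ml [|j] //=; exact: ml. Qed.

Lemma all_measurable_tail A l : all_measurable (A :: l) -> measurable A /\ all_measurable l.
Proof. by move=> ml; split; [exact: (ml 0%N)|move=> j; exact: (ml j.+1)]. Qed.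

Lemma cyl_fun_unit l : all_measurable l -> unit_fun (cyl_fun l).
Proof.
elim: l => [_|A l IH /all_measurable_tail[mA /IH ul]]; first exact: unit_fun_cst1.
by apply: unit_fun_indicM => //; exact: kernel_op_unit.
Qed.

Lemma unit_fun_Lfun2 (pi : probability E R) (h : E -> R) : unit_fun h -> h \in Lfun pi 2%:E.
Proof.
move=> hu; have [mh _] := hu.
have L2 : inL pi 2 h by apply: (@inL_bounded _ E R pi _ 1) => // x; exact: unit_fun_norm.
rewrite inE; apply/andP; split; rewrite inE//=.
by rewrite /finite_norm LnormE// ltry.
Qed.

Section reversal.
Variable pi : probability E R.
Hypothesis rv : reversible pi Q.

(** Self-adjointness moves the kernel operator from the right factor to the left; the head of [l2]
    then multiplies the left factor and becomes its new first set. Repeating this is exactly the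
    accumulation performed by [catrev]. *)
Let cyl_fun_catrev l2 : forall A l1, measurable A -> all_measurable l1 -> all_measurable l2 ->
  Rintegral pi setT (fun x => cyl_fun (A :: l1) x * kernel_op Q (cyl_fun l2) x) =
  Rintegral pi setT (cyl_fun (catrev l2 (A :: l1))).
Proof.
elim: l2 => [|B l2 IH] A l1 mA ml1 ml2.
  by apply: eq_Rintegral => x _; rewrite kernel_op_cst1 mulr1.
have [mB {}ml2] := all_measurable_tail ml2.
have u1 := cyl_fun_unit (all_measurable_cons mA ml1).
have u2 := cyl_fun_unit (all_measurable_cons mB ml2).
rewrite -(rv (unit_fun_Lfun2 pi u1) (unit_fun_Lfun2 pi u2)).
rewrite /= -IH//; last exact: all_measurable_cons.
by apply: eq_Rintegral => x _ /=; rewrite mulrCA mulrA.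
Qed.

Lemma cyl_fun_rev l : all_measurable l ->
  Rintegral pi setT (cyl_fun (rev l)) = Rintegral pi setT (cyl_fun l).
Proof.
case: l => [//|A l /all_measurable_tail[mA ml]].
have ml0 : all_measurable [::] by move=> j; rewrite nth_nil.
rewrite /rev /= -cyl_fun_catrev//; apply: eq_Rintegral => x _ /=.
by rewrite kernel_op_cst1 mulr1.
Qed.

End reversal.
End cylinders.

Section reversible_rectangles.
Context d dE (T : measurableType d) (E : measurableType dE) (R : realType)
  (P : probability T R) (zeta : int -> {RV P >-> E}) (Q : R.-pker E ~> E).
Hypotheses (st : stationary zeta) (mk : markov_property zeta)
  (tk : transition_kernel zeta Q).
Local Notation Ex X := (Rintegral P setT X).

Fixpoint path_event (k : int) (l : seq (set E)) : set T :=
  if l is A :: l' then zeta k @^-1` A `&` path_event (k + 1) l' else setT.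

Lemma path_event_measurable l : all_measurable l -> forall k, measurable (path_event k l).
Proof.
elim: l => [|A l IH] ml k //=; have [mA {}ml] := all_measurable_tail ml.
apply: measurableI; last exact: IH.
by rewrite -[_ @^-1` _]setTI; exact: (measurable_funP (zeta k)).
Qed.

Lemma path_eventP l : forall k w,
  path_event k l w <-> forall j, (j < size l)%N -> nth setT l j (zeta (k + j%:Z) w).
Proof.
elim: l => [|A l IH] k w /=; first by split.
split=> [[hA /IH h] [|j] hj /=|h]; first by rewrite addr0.
  by have := h j hj; rewrite -addrA (_ : 1 + j%:Z = j.+1%:Z)// addrC -natr1.
split; first by have := h 0%N isT; rewrite addr0.
apply/IH => j hj; have := h j.+1 hj => /=.
by rewrite -addrA (_ : 1 + j%:Z = j.+1%:Z)// -natr1 addrC.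
Qed.

(** A general event [B] of the past lets the induction absorb the visit to the first set into [B],
    which then lies in the past of [k + 1]. *)
Lemma path_event_cyl_fun l : all_measurable l -> forall k B, past zeta k B ->
  Ex (fun w => \1_B w * \1_(path_event k l) w) = Ex (fun w => \1_B w * cyl_fun Q l (zeta k w)).
Proof.
elim: l => [_ k B _|A l IH /all_measurable_tail[mA ml] k B pB].
  by apply: eq_Rintegral => w _; rewrite /= indicT.
have pBA : past zeta k (B `&` zeta k @^-1` A).
  have := @measurableI _ (g_sigma_algebraType (past zeta k)) B (zeta k @^-1` A).
  rewrite measurable_g_measurableTypeE; last exact: past_sigma_algebra.
  by apply => //; exact: present_past.
have pBA' : past zeta (k + 1) (B `&` zeta k @^-1` A).
  by apply: past_mono pBA; rewrite lerDl.
transitivity (Ex (fun w => \1_(B `&` zeta k @^-1` A) w * \1_(path_event (k + 1) l) w)).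
  by apply: eq_Rintegral => w _; rewrite /= !indicI /= mulrA.
rewrite IH// (markov_unit_fun st mk tk (cyl_fun_unit Q ml) pBA).
by apply: eq_Rintegral => w _; rewrite indicI /= -mulrA.
Qed.

Let pi := distribution P (zeta 0).

Lemma path_event_prob l k : all_measurable l ->
  fine (P (path_event k l)) = Rintegral pi setT (cyl_fun Q l).
Proof.
move=> ml; have [mq _] := cyl_fun_unit Q ml.
have pT : past zeta k setT.
  by have := @present_past _ _ _ _ _ _ zeta k setT measurableT; rewrite preimage_setT.
have := path_event_cyl_fun ml pT.
have -> : Ex (fun w => \1_[set: T] w * \1_(path_event k l) w) = fine (P (path_event k l)).
  rewrite (@eq_Rintegral _ _ R _ setT (\1_(path_event k l))) => [|w _]; last by rewrite indicT mul1r.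
  by rewrite /Rintegral integral_indic ?setIT//; exact: path_event_measurable.
move=> ->; rewrite (_ : Ex _ = Ex (fun w => cyl_fun Q l (zeta k w))); last first.
  by apply: eq_Rintegral => w _; rewrite indicT mul1r.
rewrite (eq_law_Ex (stationary1 st k) mq) /Rintegral; congr fine.
by rewrite integral_distributionE// preimage_setT.
Qed.

Hypothesis rv : reversible pi Q.

(** On a time window symmetric about 0, reflecting time amounts to reversing the list of sets, and
    [cyl_fun_rev] equates the probabilities. *)
Lemma reversal_rectangle (s : seq int) (A : int -> set E) : (forall i, measurable (A i)) ->
  P (\bigcap_(i in [set` s]) zeta (- i) @^-1` A i) = P (\bigcap_(i in [set` s]) zeta i @^-1` A i).
Proof.
move=> mA; pose N := (\sum_(i <- s) `|i|)%N.
have sN i : i \in s -> (`|i| <= N)%N.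
  by move=> si; rewrite /N (big_rem i)//= leq_addr.
(* Times of the window from -N to N outside [s] are left unconstrained. *)
pose A' i := if i \in s then A i else setT.
have mA' i : measurable (A' i) by rewrite /A'; case: ifP.
pose l := mkseq (fun j => A' (j%:Z - N%:Z)) N.*2.+1.
have sl : size l = N.*2.+1 by rewrite size_mkseq.
have ml : all_measurable l.
  move=> j; have [jl|jl] := ltnP j N.*2.+1; first by rewrite nth_mkseq.
  by rewrite nth_default// sl.
have mr : all_measurable (rev l).
  move=> j; have [jl|jl] := ltnP j N.*2.+1; last by rewrite nth_default// size_rev sl.
  by rewrite nth_rev ?sl//; exact: ml.
have e1 : \bigcap_(i in [set` s]) zeta i @^-1` A i = path_event (- N%:Z) l.
  apply/seteqP; split=> [w h|w /path_eventP h i /= si].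
    apply/path_eventP => j; rewrite sl => jl; rewrite nth_mkseq// /A'.
    by rewrite addrC; case: ifP => // js; exact: (h _ js).
  have := h (absz (i + N%:Z)%R); rewrite sl.
  have [jl ji _] := shift_window (sN _ si).
  move=> /(_ jl); rewrite nth_mkseq// ji addrK /A' si.
  by rewrite addrC addrK.
have e2 : \bigcap_(i in [set` s]) zeta (- i) @^-1` A i = path_event (- N%:Z) (rev l).
  apply/seteqP; split=> [w h|w /path_eventP h i /= si].
    apply/path_eventP => j; rewrite size_rev sl => jl; rewrite nth_rev ?sl// nth_mkseq; last by lia.
    rewrite /A'; have -> : (N.*2.+1 - j.+1)%N%:Z - N%:Z = - (- N%:Z + j%:Z) by move: jl; lia.
    by case: ifP => // js; have := h _ js; rewrite /= opprK.
  have [_ _ jE] := shift_window (sN _ si).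
  have [jl ji _] : [/\ (absz (N%:Z - i)%R < N.*2.+1)%N, (absz (N%:Z - i)%R)%:Z = N%:Z - i & True].
    by have := @shift_window (- i) N; rewrite abszN addrC => /(_ (sN _ si))[].
  have := h (absz (N%:Z - i)%R); rewrite size_rev sl => /(_ jl); rewrite nth_rev ?sl// nth_mkseq; last by lia.
  rewrite ji jE.
  by rewrite /A' si addrA addNr add0r.
rewrite e1 e2; apply/eqP; rewrite -(@fineK _ (P _)) ?fin_num_measure//; last exact: path_event_measurable.
rewrite -[eqbRHS]fineK ?fin_num_measure//; last exact: path_event_measurable.
by rewrite !path_event_prob// (cyl_fun_rev rv).
Qed.

End reversible_rectangles.

(** * The path space *)

Section path_space.
Context dE (E : measurableType dE).

Definition rectangles : set (set (int -> E)) :=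
  [set C | exists (s : seq int) (A : int -> set E), (forall i, measurable (A i)) /\
     C = \bigcap_(i in [set` s]) (fun x => x i) @^-1` A i].

Definition path_type := g_sigma_algebraType rectangles.

HB.instance Definition _ := Measurable.on path_type.

Lemma coord_measurable i : measurable_fun [set: path_type] (fun x : path_type => x i).
Proof.
move=> _ A mA; rewrite setTI; apply: sub_sigma_algebra.
exists [:: i], (fun=> A); split => //.
apply/seteqP; split=> [x h j /=|x /(_ i)]; first by rewrite inE => /eqP ->.
by apply; rewrite /= inE.
Qed.

Lemma rectangles_setI : setI_closed rectangles.
Proof.
move=> _ _ [s1 [A1 [m1 ->]]] [s2 [A2 [m2 ->]]].
exists (s1 ++ s2), (fun i => (if i \in s1 then A1 i else setT) `&` (if i \in s2 then A2 i else setT)).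
split=> [i|]; first by apply: measurableI; case: ifP.
apply/seteqP; split=> [x [h1 h2] i /= _|x h].
  by split; case: ifP => // si; [exact: h1|exact: h2].
split=> i /= si; have := h i; rewrite /= mem_cat si ?orbT => /(_ isT)[].
  by [].
by [].
Qed.

Lemma rectangles_setT : rectangles setT.
Proof.
by exists [::], (fun=> setT); split => //; apply/seteqP; split.
Qed.

Definition path_past : set (set path_type) :=
  <<s \bigcup_(i in [set i : int | i <= 0])
      g_sigma_algebra_preimage (fun x : path_type => x i) >>.

Lemma path_past_sigma_algebra : sigma_algebra setT path_past.
Proof. exact: smallest_sigma_algebra. Qed.

Lemma path_past_measurable : path_past `<=` measurable.
Proof.
apply: smallest_sub; first exact: sigma_algebra_measurable.
by move=> A [i _ [B mB <-]]; exact: coord_measurable.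
Qed.

End path_space.

Section paths.
Context d dE (T : measurableType d) (E : measurableType dE) (R : realType)
  (P : probability T R) (zeta : int -> {RV P >-> E}).

(** [s] re-indexes time, so that shifts and the reflection of the path are handled alike. *)
Definition path_map (s : int -> int) : T -> path_type E := fun w i => zeta (s i) w.

Lemma path_map_measurable s : measurable_fun setT (path_map s).
Proof.
apply: (@measurability _ _ T (path_type E) setT _ (@rectangles _ E)) => //.
move=> _ [_ [r [A [mA ->]]] <-].
rewrite setTI (_ : _ @^-1` _ = \bigcap_(i in [set` r]) (zeta (s i) @^-1` A i))//.
apply: fin_bigcap_measurable => [|i _]; first exact: finite_seq.
by rewrite -[_ @^-1` _]setTI; exact: (measurable_funP (zeta (s i))).
Qed.

Definition path_rv s : {RV P >-> path_type E} :=
  MeasurableFun.Pack (MeasurableFun.Class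
    (isMeasurableFun.Build _ _ T (path_type E) (path_map s) (path_map_measurable s))).

(** Rectangles generate the sigma-algebra of the path space and are stable under intersection, so
    they determine the law. *)
Lemma path_rv_law s : (forall (r : seq int) A, (forall i, measurable (A i)) ->
    P (\bigcap_(i in [set` r]) zeta (s i) @^-1` A i) =
    P (\bigcap_(i in [set` r]) zeta i @^-1` A i)) ->
  eq_law (path_rv s) (path_rv id).
Proof.
move=> H C mC.
have := @measure_unique _ R (path_type E) (@rectangles _ E) (fun=> setT) erefl
  (@rectangles_setI _ E) (fun=> @rectangles_setT _ E) _
  (distribution P (path_rv s)) (distribution P (path_rv id)) _ _ C mC.
apply.
- by apply/seteqP; split => // x _; exists 0%N.
- by move=> _ [r [A [mA ->]]]; exact: H.
- by move=> _; change (P setT < +oo)%E; rewrite probability_setT ltry.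
Qed.

Definition shift_rv (k : int) := path_rv (fun i => i + k).

Lemma past_path k : past zeta k = preimage_set_system setT (shift_rv k) (@path_past _ E).
Proof.
rewrite /past; have -> : \bigcup_(i in [set i | i <= k]) g_sigma_algebra_preimage (zeta i) =
    preimage_set_system setT (shift_rv k) (\bigcup_(i in [set i : int | i <= 0])
      g_sigma_algebra_preimage (fun x : path_type E => x i)).
  apply/seteqP; split=> [_ [i /= ik [B mB <-]]|_ [_ [i /= i0 [B mB <-]] <-]].
    exists ((fun x : path_type E => x (i - k)) @^-1` B).
      exists (i - k) => /=; first by rewrite subr_le0.
      by exists B => //; rewrite setTI.
    rewrite !setTI; apply/seteqP; split=> w; rewrite /= /path_map subrK//.
  exists (i + k) => /=; first by rewrite gerDr.
  by exists B => //; rewrite !setTI.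
exact: g_sigma_preimageE.
Qed.

Hypothesis shift_law : forall k, eq_law (shift_rv k) (path_rv id).

Let PO := distribution P (path_rv id).

Lemma path_integrable (G : path_type E -> R) : measurable_fun setT G ->
  PO.-integrable setT (EFin \o G) <->
  P.-integrable setT (EFin \o (fun w => G (path_rv id w))).
Proof.
move=> mG.
have mG' : measurable_fun setT (fun x => `|G x|) by exact: measurableT_comp.
have e : (\int[PO]_x `|(EFin \o G) x| = \int[P]_w `|(EFin \o (fun w => G (path_rv id w))) w|)%E.
  have := @integral_distributionE _ _ T (path_type E) R P (path_rv id) setT _ measurableT mG'.
  by rewrite preimage_setT.
split=> /integrableP[_ h]; apply/integrableP; split.
- apply/measurable_EFinP; apply: measurableT_comp => //; exact: measurable_funP.
- by rewrite -e.
- exact/measurable_EFinP.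
- by rewrite e.
Qed.

Section version.
Variable G : path_type E -> R.
Hypotheses (mG : measurable_fun setT G)
  (iG : P.-integrable setT (EFin \o (fun w => G (path_rv id w)))).

(* Conditioning on the path space makes the versions given the pasts at all
   times the shifts of a single function: their norms do not depend on the
   time. *)
Definition path_condexp : path_type E -> R := condexp PO (@path_past _ E) G.

Let PGI : PO.-integrable setT (EFin \o G). Proof. exact/path_integrable. Qed.

Let cH : is_condexp PO (@path_past _ E) G path_condexp.
Proof. exact: (condexpP (@path_past_sigma_algebra _ E) (@path_past_measurable _ E) PGI). Qed.

Lemma path_condexp_measurable : measurable_fun setT path_condexp.
Proof.
apply: (Fm_meas (@path_past_measurable _ E)).
exact: (is_condexp_Fm (@path_past_sigma_algebra _ E) cH).
Qed.

Lemma path_condexpP k :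
  is_condexp P (past zeta k) (fun w => G (shift_rv k w)) (fun w => path_condexp (shift_rv k w)).
Proof.
have [mH iH hH] := cH.
have mH' := path_condexp_measurable.
have sym C : measurable C -> P (path_rv id @^-1` C) = P (shift_rv k @^-1` C).
  by move=> mC; rewrite shift_law.
split.
- move=> B mB; rewrite past_path; exists (path_condexp @^-1` B); first exact: mH.
  by rewrite setTI.
- apply: (eq_law_integrable (X := path_rv id)) => //.
  exact/path_integrable.
- move=> A; rewrite past_path => -[C pC <-]; rewrite setTI.
  have mC := path_past_measurable pC.
  rewrite (eq_law_integral (@shift_law k) mC mH') (eq_law_integral (@shift_law k) mC mG).
  by rewrite -!integral_distributionE//; exact: hH.
Qed.

Lemma Ln_path_condexp m k l : Ln P m (fun w => path_condexp (shift_rv k w)) =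
  Ln P m (fun w => path_condexp (shift_rv l w)).
Proof.
have mH : measurable_fun setT (fun x => `|path_condexp x| ^+ m).
  by apply: measurable_funX; apply: measurableT_comp => //; exact: path_condexp_measurable.
rewrite !LnE; congr (_ `^ _).
by rewrite (eq_law_Ex (@shift_law k) mH) (eq_law_Ex (@shift_law l) mH).
Qed.

End version.
End paths.

Section reversible_paths.
Context d dE (T : measurableType d) (E : measurableType dE) (R : realType)
  (P : probability T R) (zeta : int -> {RV P >-> E}) (Q : R.-pker E ~> E).
Hypotheses (st : stationary zeta) (mk : markov_property zeta)
  (tk : transition_kernel zeta Q) (rv : reversible (distribution P (zeta 0)) Q).

Lemma shift_rv_law k : eq_law (shift_rv zeta k) (path_rv zeta id).
Proof. by apply: path_rv_law => r A mA; exact: st. Qed.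

Lemma reverse_rv_law : eq_law (path_rv zeta -%R) (path_rv zeta id).
Proof. by apply: path_rv_law => r A mA; exact: (reversal_rectangle st mk tk rv). Qed.

Variables (f : E -> R) (mf : measurable_fun setT f).

Definition path_sum (m : nat) (c : int -> int) (x : path_type E) : R :=
  \sum_(1 <= i < m.+1) f (x (c i%:Z)).

Lemma path_sum_measurable m c : measurable_fun setT (path_sum m c).
Proof.
rewrite /path_sum; elim: (index_iota _ _) => [|i r IH].
  rewrite (_ : (fun x => _) = cst 0); first exact: measurable_cst.
  by apply/funext => x; rewrite big_nil.
rewrite (_ : (fun x => _) = (fun x : path_type E => f (x (c i)) +
    \sum_(i <- r) f (x (c i%:Z)))); last by apply/funext => x; rewrite big_cons.
apply: measurable_funD => //.
by apply: measurableT_comp => //; exact: coord_measurable.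
Qed.

Lemma partial_sum_increment k m w :
  partial_sum zeta f (k + m) w - partial_sum zeta f k w = path_sum m id (shift_rv zeta k%:Z w).
Proof.
rewrite /partial_sum (big_cat_nat (n := k.+1))//=; last by rewrite ltnS leq_addr.
rewrite addrAC subrr add0r -{1}(add1n k) big_addn.
have -> : ((k + m).+1 - k = m.+1)%N by lia.
by apply: eq_bigr => i _; rewrite /= /path_map PoszD.
Qed.

Lemma reversed_moments j a b :
  Rintegral P setT (fun w => partial_sum zeta f j w ^+ a *
     (partial_sum zeta f (j + j) w - partial_sum zeta f j w) ^+ b) =
  Rintegral P setT (fun w => partial_sum zeta f j w ^+ b *
     (partial_sum zeta f (j + j) w - partial_sum zeta f j w) ^+ a).
Proof.
(* The reflection i -> c - i exchanges the blocks 1..j and j+1..2j; it is obtained from a shift by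
   [- c] and the reflection about 0. *)
pose c : int := j.*2.+1%:Z.
pose G (x : path_type E) := path_sum j (fun i => i - c) x ^+ a *
  path_sum j (fun i => i + j%:Z - c) x ^+ b.
have mG : measurable_fun setT G.
  by apply: measurable_funM; apply: measurable_funX; exact: path_sum_measurable.
pose G0 (x : path_type E) := path_sum j id x ^+ a * path_sum j (fun i => i + j%:Z) x ^+ b.
have mG0 : measurable_fun setT G0.
  by apply: measurable_funM; apply: measurable_funX; exact: path_sum_measurable.
transitivity (Rintegral P setT (fun w => G0 (path_rv zeta id w))).
  by apply: eq_Rintegral => w _; rewrite partial_sum_increment.
rewrite -(eq_law_Ex (shift_rv_law (- c)) mG0).
transitivity (Rintegral P setT (fun w => G (path_rv zeta id w))).
  by apply: eq_Rintegral => w _.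
rewrite -(eq_law_Ex reverse_rv_law mG); apply: eq_Rintegral => w _.
rewrite /G partial_sum_increment mulrC; congr (_ ^+ _ * _ ^+ _).
  rewrite /path_sum big_nat_rev /= /partial_sum !big_nat; apply: eq_bigr => i /andP[i1 i2].
  by congr (f (zeta _ w)); rewrite /c; lia.
rewrite /path_sum big_nat_rev /= !big_nat; apply: eq_bigr => i /andP[i1 i2].
by congr (f (zeta _ w)); rewrite /c; lia.
Qed.

End reversible_paths.

(** * The moment bound *)

Lemma combine_final_le (R : realDomainType) (c n a b y x z e : R) :
  0 <= c -> 0 <= n -> 0 <= a -> 0 <= b -> 1 <= e -> y <= e * (x + z) ->
  c * n * (a + b + y) <= c * e * n * (a + b + x + z).
Proof.
move=> c0 n0 a0 b0 e1 hy.
have h1 : 0 <= (e - 1) * a by rewrite mulr_ge0 ?subr_ge0.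
have h2 : 0 <= (e - 1) * b by rewrite mulr_ge0 ?subr_ge0.
rewrite (_ : c * e * n * _ = c * n * (e * (a + b + x + z))); last by ring.
by apply: ler_wpM2l; [exact: mulr_ge0|lra].
Qed.

Section norm_comparison.
Context d (T : measurableType d) (R : realType) (P : probability T R).
Implicit Types X Y : T -> R.
Local Notation Ex X := (Rintegral P setT X).

Lemma Ln_ae m X Y : measurable_fun setT X -> measurable_fun setT Y ->
  X = Y %[ae P] -> Ln P m X = Ln P m Y.
Proof.
move=> mX mY XY; rewrite !LnE; congr (_ `^ _); congr fine.
apply: ae_eq_integral => //.
- by apply/measurable_EFinP/measurable_funX; exact: measurableT_comp.
- by apply/measurable_EFinP/measurable_funX; exact: measurableT_comp.
- by apply: filterS XY => w /= h _; rewrite h.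
Qed.

(** This separates the norm of E_0 S_k^2 into its centred part and its mean. The 4 is 2 from
    [normD_expr_le] times 2 from x^m + c^m <= 2^m (x + c)^m. *)
Lemma Ln_center_le m X c : (0 < m)%N -> 0 <= c -> inL P m X ->
  Ln P m X <= 4 * (Ln P m (fun w => X w - c) + c).
Proof.
move=> m0 c0 LX; have [mX iX] := LX.
have Lc : inL P m (cst c) by apply: (@inL_bounded _ T R P m `|c|).
have [mXc iXc] : inL P m (fun w => X w - c) by apply: (inLD LX); exact: inLN Lc.
set x := Ln P m (fun w => X w - c); have x0 : 0 <= x by exact: Ln_ge0.
apply: Ln_le => //; first by rewrite mulr_ge0 ?addr_ge0.
apply: (@le_trans _ _ (Ex (fun w => 2 ^+ m * (`|X w - c| ^+ m + c ^+ m)))).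
  apply: Ex_le => //; first by apply: IntZ; apply: IntD => //; exact: Int_cst.
  move=> w; have := normD_expr_le m (X w - c) c.
  by rewrite subrK (ger0_norm c0).
rewrite ExZ; last by apply: IntD => //; exact: Int_cst.
rewrite ExD//; last exact: Int_cst.
have PT : fine (P setT) = 1 by rewrite probability_setT.
rewrite -Ln_exp// -/x Rintegral_cst// [fine _]PT mulr1.
rewrite (_ : 4 = 2 * 2); last by ring.
rewrite -mulrA exprMn ler_wpM2l ?exprn_ge0// exprMn.
have h1 : x ^+ m <= (x + c) ^+ m by rewrite lerXn2r ?nnegrE ?addr_ge0// lerDl.
have h2 : c ^+ m <= (x + c) ^+ m by rewrite lerXn2r ?nnegrE ?addr_ge0// lerDr.
have h3 : 0 <= (x + c) ^+ m by rewrite exprn_ge0 ?addr_ge0.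
have h4 : 2 <= 2 ^+ m :> R by case: m m0 {h1 h2 h3 x x0 mXc iXc Lc LX iX} => // m _; rewrite exprS ler_peMr// exprn_ege1// ler1n.
have := ler_wpM2r h3 h4; lra.
Qed.

Lemma measurable_bigmax (r : seq nat) (F : nat -> T -> R) :
  (forall k, measurable_fun setT (F k)) ->
  measurable_fun setT (fun w => \big[Num.max/0]_(k <- r) F k w).
Proof.
move=> mF; elim: r => [|k r IH].
  by under eq_fun do rewrite big_nil; exact: measurable_cst.
by under eq_fun do rewrite big_cons; exact: measurable_maxr.
Qed.

End norm_comparison.

(** * The abstract bound applied to the chain *)

Section reversible_moment_bound.
Context (R : realType) (h : nat).
Context d dE (T : measurableType d) (E : measurableType dE) (P : probability T R)
  (zeta : int -> {RV P >-> E}) (Q : R.-pker E ~> E) (f : E -> R).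
Hypotheses (st : stationary zeta) (mk : markov_property zeta)
  (tk : transition_kernel zeta Q) (rv : reversible (distribution P (zeta 0)) Q)
  (mf : measurable_fun setT f)
  (ff : (\int[distribution P (zeta 0)]_x (`|f x| ^+ h.*2.+4)%:E < +oo)%E).
Local Notation p := h.*2.+4.
Local Notation m := h.+2.
Local Notation Ex X := (Rintegral P setT X).
Local Notation S := (partial_sum zeta f).
Local Notation E0 := (condexp P (past zeta 0)).

Let mfp : measurable_fun setT (fun x => `|f x| ^+ p).
Proof. by apply: measurable_funX; exact: measurableT_comp. Qed.

Let f_inL k : inL P p (fun w => f (zeta k w)).
Proof.
split; first by apply: measurableT_comp => //; exact: measurable_funP.
apply: (@eq_law_integrable _ _ T E R P (zeta 0) (zeta k) _ (fun x => `|f x| ^+ p)) => //.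
  by move=> C mC; rewrite (stationary1 st).
apply/integrableP; split.
  by apply/measurable_EFinP; apply: measurableT_comp mfp _; exact: measurable_funP.
move: ff; rewrite integral_distributionE// preimage_setT.
move=> /(le_lt_trans _); apply; rewrite le_eqVlt; apply/orP; left; apply/eqP.
by apply: eq_integral => w _; rewrite /= normrX normr_id.
Qed.

Let S_inL k : inL P p (S k).
Proof. by apply: inL_sum => i; exact: f_inL. Qed.

Let shift_law k := shift_rv_law st k.

Let mps j c : measurable_fun setT (path_sum f j c). Proof. exact: path_sum_measurable. Qed.

Let G1 j : path_type E -> R := path_sum f j id.
Let G2 j : path_type E -> R := fun x => path_sum f j id x ^+ 2.

Let mG1 j : measurable_fun setT (G1 j). Proof. exact: mps. Qed.
Let mG2 j : measurable_fun setT (G2 j). Proof. by apply: measurable_funX; exact: mps. Qed.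

Let iG1 j : P.-integrable setT (EFin \o (fun w => G1 j (path_rv zeta id w))).
Proof. exact: inL_Int (S_inL j). Qed.

Let S2_inL j : inL P m (fun w => S j w ^+ 2).
Proof. by apply: inL_exp; rewrite mul2n. Qed.

Let iG2 j : P.-integrable setT (EFin \o (fun w => G2 j (path_rv zeta id w))).
Proof. exact: inL_Int (S2_inL j). Qed.

Let D k j w := path_condexp zeta (G1 j) (shift_rv zeta (Posz k) w).
Let V k j w := path_condexp zeta (G2 j) (shift_rv zeta (Posz k) w).

Let DP k j : is_condexp P (past zeta (Posz k)) (fun w => S (k + j) w - S k w) (D k j).
Proof.
have := path_condexpP shift_law (mG1 j) (iG1 j) (Posz k).
by congr is_condexp; apply/funext => w; rewrite partial_sum_increment.
Qed.

Let VP k j : is_condexp P (past zeta (Posz k)) (fun w => (S (k + j) w - S k w) ^+ 2) (V k j).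
Proof.
have := path_condexpP shift_law (mG2 j) (iG2 j) (Posz k).
by congr is_condexp; apply/funext => w; rewrite partial_sum_increment.
Qed.

Let S0 w : S 0 w = 0. Proof. by rewrite /partial_sum big_geq. Qed.

Let SF k : Fm (past zeta (Posz k)) (S k).
Proof.
rewrite /Fm /partial_sum.
have : forall i, (i <= k)%N -> Fm (past zeta (Posz k)) (fun w => f (zeta (Posz i) w)).
  move=> i ik _ B mB; rewrite setTI measurable_g_measurableTypeE; last exact: past_sigma_algebra.
  apply: (@past_mono _ _ _ _ _ _ zeta (Posz i)); first by rewrite lez_nat.
  have mfB : measurable (f @^-1` B) by rewrite -[_ @^-1` _]setTI; exact: mf.
  exact: (@present_past _ _ _ _ _ _ zeta (Posz i) _ mfB).
move=> H.
have : forall j, (j <= k)%N ->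
    measurable_fun [set: g_sigma_algebraType (past zeta (Posz k))]
      (fun w => \sum_(1 <= i < j.+1) f (zeta (Posz i) w) : R).
  elim=> [|j IH] jk.
    by under eq_fun do rewrite big_geq//; exact: measurable_cst.
  under eq_fun do rewrite big_nat_recr//=; apply: measurable_funD; first exact: IH (ltnW jk).
  exact: H.
by apply.
Qed.

Let SE k j : Ln P p (fun w => S (k + j) w - S k w) = Ln P p (S j).
Proof.
have mH : measurable_fun setT (fun x => `|G1 j x| ^+ p).
  by apply: measurable_funX; exact: measurableT_comp.
rewrite !LnE; congr (_ `^ _); have := eq_law_Ex (shift_law (Posz k)) mH.
by under eq_Rintegral do rewrite /G1 -partial_sum_increment.
Qed.

Let ME k n : Ln P p (running_max (fun i w => `|S (k + i.+1) w - S k w|) n) =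
             Ln P p (running_max (fun i w => `|S (0 + i.+1) w - S 0 w|) n).
Proof.
pose Gn := running_max (fun i (x : path_type E) => `|G1 i.+1 x|).
have mGn l : measurable_fun setT (Gn l).
  rewrite /Gn; elim: l => [|l IH] /=; first exact: measurable_cst.
  by apply: measurable_maxr => //; exact: measurableT_comp.
have GnE j (l : nat) w : Gn j (shift_rv zeta (Posz l) w) =
    running_max (fun i w => `|S (l + i.+1) w - S l w|) j w.
  by rewrite /Gn; elim: j => [//|i IH] /=; rewrite IH partial_sum_increment.
have mH : measurable_fun setT (fun x => `|Gn n x| ^+ p).
  by apply: measurable_funX; exact: measurableT_comp.
rewrite !LnE; congr (_ `^ _).
have := eq_law_Ex (shift_law (Posz k)) mH; rewrite -(eq_law_Ex (shift_law 0) mH).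
under eq_Rintegral do rewrite (GnE n k).
by under [X in _ = X -> _]eq_Rintegral do rewrite (GnE n 0%N).
Qed.

Let past0 := past_sigma_algebra zeta 0.
Let past0m := @past_measurable _ _ _ _ _ _ zeta 0.

Let SI k : P.-integrable setT (EFin \o S k). Proof. exact: inL_Int (S_inL k). Qed.
Let S2I k : P.-integrable setT (EFin \o (fun w => S k w ^+ 2)). Proof. exact: inL_Int (S2_inL k). Qed.

(** The final bound involves the version chosen by [condexp], the recursion the one built on paths;
    a.e. uniqueness equates their norms. *)
Let uE k : Ln P p (D 0 k) = Ln P p (E0 (S k)).
Proof.
have c1 := condexpP past0 past0m (SI k).
have c2 : is_condexp P (past zeta 0) (S k) (D 0 k).
  have := DP 0 k; congr is_condexp; apply/funext => w.
  by rewrite S0 subr0.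
apply: Ln_ae; last exact: (condexp_unique past0 past0m (SI k) c2 c1).
- exact: (Fm_meas past0m (is_condexp_Fm past0 c2)).
- exact: (Fm_meas past0m (is_condexp_Fm past0 c1)).
Qed.

Let vE k : Ln P m (V 0 k) = Ln P m (E0 (fun w => S k w ^+ 2)).
Proof.
have c1 := condexpP past0 past0m (S2I k).
have c2 : is_condexp P (past zeta 0) (fun w => S k w ^+ 2) (V 0 k).
  have := VP 0 k; congr is_condexp; apply/funext => w.
  by rewrite S0 subr0.
apply: Ln_ae; last exact: (condexp_unique past0 past0m (S2I k) c2 c1).
- exact: (Fm_meas past0m (is_condexp_Fm past0 c2)).
- exact: (Fm_meas past0m (is_condexp_Fm past0 c1)).
Qed.

Lemma condexp_S_inL k : inL P p (E0 (S k)).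
Proof. exact: (Ln_condexp past0 past0m (condexpP past0 past0m (SI k)) (S_inL k)). Qed.

Lemma condexp_S2_inL k : inL P m (E0 (fun w => S k w ^+ 2)).
Proof. exact: (Ln_condexp past0 past0m (condexpP past0 past0m (S2I k)) (S2_inL k)). Qed.

Let Hu n := \sum_(1 <= k < n.+1) (k%:R `^ (1 + 1 / p%:R))^-1 * Ln P p (E0 (S k)).
Let Ha n := \sum_(1 <= k < n.+1) (k%:R `^ (1 + 2 / p%:R))^-1 *
  Ln P m (fun w => E0 (fun w => S k w ^+ 2) w - Ex (fun w => S k w ^+ 2)).
Let Hb n := \sum_(1 <= k < n.+1) (k%:R `^ (1 + 2 / p%:R))^-1 * Ex (fun w => S k w ^+ 2).

Lemma reversible_moment_bound n : (0 < n)%N ->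
  Ln P p (running_max (fun i w => `|S (0 + i.+1) w - S 0 w|) n) ^+ p <=
  moment_const R h * 8 ^+ m * n%:R * (Ex (fun w => `|f (zeta 1 w)| ^+ p)
     + Hu n ^+ p + Ha n ^+ m + Hb n ^+ m).
Proof.
move=> n0.
have rev1 j : Ex (fun w => S j w * (S (j + j) w - S j w) ^+ h.*2.+3) =
    Ex (fun w => S j w ^+ h.*2.+3 * (S (j + j) w - S j w)).
  exact: (reversed_moments st mk tk rv mf j 1 h.*2.+3).
have rev2 j := reversed_moments st mk tk rv mf j 2 h.*2.+2.
have := @moment_max_bound _ T R P h (fun k => past zeta (Posz k)) S D V
  (fun k => past_sigma_algebra zeta (Posz k)) (fun k => @past_measurable _ _ _ _ _ _ zeta (Posz k))
  (fun i j ij => @past_mono _ _ _ _ _ _ zeta (Posz i) (Posz j) ij) S0 SF S_inL DP VP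
  (fun k j => Ln_path_condexp shift_law (mG1 j) (iG1 j) p (Posz k) 0)
  (fun k j => Ln_path_condexp shift_law (mG2 j) (iG2 j) m (Posz k) 0)
  SE rev1 rev2 ME n n0.
move=> /le_trans; apply.
have e1 : Ln P p (S 1) ^+ p = Ex (fun w => `|f (zeta 1 w)| ^+ p).
  by rewrite Ln_exp//; apply: eq_Rintegral => w _; rewrite /partial_sum big_nat1.
have eu : \sum_(1 <= k < n.+1) (k%:R `^ (1 + 1 / p%:R))^-1 * Ln P p (D 0 k) = Hu n.
  by apply: eq_bigr => k _; rewrite uE.
have w0 k : 0 <= (k%:R `^ (1 + 2 / p%:R))^-1 :> R by rewrite invr_ge0 powR_ge0.
have ev : \sum_(1 <= k < n.+1) (k%:R `^ (1 + 2 / p%:R))^-1 * Ln P m (V 0 k) <= 4 * (Ha n + Hb n).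
  rewrite /Ha /Hb -big_split/= mulr_sumr; apply: ler_sum => k _.
  rewrite -mulrDr mulrCA ler_wpM2l// vE; apply: Ln_center_le => //.
    by apply: Ex_ge0 => w; rewrite sqr_ge0.
  exact: condexp_S2_inL.
have ev0 : 0 <= \sum_(1 <= k < n.+1) (k%:R `^ (1 + 2 / p%:R))^-1 * Ln P m (V 0 k).
  by apply: sumr_ge0 => k _; rewrite mulr_ge0 ?Ln_ge0.
have Ha0 : 0 <= Ha n by apply: sumr_ge0 => k _; rewrite mulr_ge0 ?Ln_ge0.
have Hb0 : 0 <= Hb n.
  by apply: sumr_ge0 => k _; rewrite mulr_ge0// Ex_ge0// => w; rewrite sqr_ge0.
have Hu0 : 0 <= Hu n by apply: sumr_ge0 => k _; rewrite mulr_ge0 ?Ln_ge0// invr_ge0 powR_ge0.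
(* 8 is the 4 of [Ln_center_le] times the 2 of [normD_expr_le], which separates the centred sum from
   the sum of the means. *)
have em : (\sum_(1 <= k < n.+1) (k%:R `^ (1 + 2 / p%:R))^-1 * Ln P m (V 0 k)) ^+ m <=
    8 ^+ m * (Ha n ^+ m + Hb n ^+ m).
  apply: (@le_trans _ _ ((4 * (Ha n + Hb n)) ^+ m)).
    by rewrite lerXn2r ?nnegrE ?mulr_ge0 ?addr_ge0.
  rewrite (_ : 8 = 4 * 2); last by ring.
  rewrite [(4 * (_ + _)) ^+ m]exprMn [(4 * 2) ^+ m]exprMn -[leRHS]mulrA ler_wpM2l ?exprn_ge0//.
  by have := normD_expr_le m (Ha n) (Hb n); rewrite !ger0_norm ?addr_ge0.
have c0 := moment_const_ge0 R h.
rewrite e1 eu.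
have a0 : 0 <= Ex (fun w => `|f (zeta 1 w)| ^+ p) by apply: Ex_ge0 => w; rewrite exprn_ge0.
have u0 : 0 <= Hu n ^+ p by rewrite exprn_ge0.
have e8 : 1 <= 8 ^+ m :> R by rewrite exprn_ege1// ler1n.
exact: combine_final_le.
Qed.

Let Mx n w := \big[Num.max/0]_(1 <= k < n.+1) (`|S k w| ^+ p).

Lemma expectation_max_bound n : (0 < n)%N ->
  ('E_P[(fun w => Mx n w)] <= (moment_const R h * 8 ^+ m * n%:R *
     (Ex (fun w => `|f (zeta 1 w)| ^+ p) + Hu n ^+ p + Ha n ^+ m + Hb n ^+ m))%:E)%E.
Proof.
move=> n0.
pose M := running_max (fun i w => `|S (0 + i.+1) w - S 0 w|) n.
have ML : inL P p M.
  apply: inL_running_max => [i|i w]; last exact: normr_ge0.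
  by apply: inL_norm; apply: inLD; [exact: S_inL|exact/inLN/S_inL].
apply: (@le_trans _ _ (Ln P p M ^+ p)%:E); last by rewrite lee_fin reversible_moment_bound.
rewrite Ln_exp// -Ex_EFin; last by case: ML.
rewrite unlock; apply: ge0_le_integral => //.
- move=> w _; rewrite lee_fin /Mx; elim/big_ind: _ => [|x y x0 _|k _]; [by []|by rewrite le_max x0|by rewrite exprn_ge0].
- apply/measurable_EFinP; apply: measurable_bigmax => k; apply: measurable_funX.
  by apply: measurableT_comp => //; case: (S_inL k).
- by case: ML => _ /measurable_int.
- move=> w _; rewrite lee_fin /Mx big_nat; elim/big_ind: _ => [|x y xm ym|k /andP[k1 k2]].
  + by rewrite exprn_ge0.
  + by rewrite ge_max xm.
  + rewrite lerXn2r ?nnegrE// [leRHS]ger0_norm ?running_max_ge0//.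
    (* Entry [k.-1] of the running maximum is time [k]. *)
    have := @le_running_max _ T R (fun i w => `|S (0 + i.+1) w - S 0 w|) n k.-1 w.
    by rewrite add0n prednK// S0 subr0; apply; lia.
Qed.

(** All the norms and expectations are finite, so the extended-real right-hand side is the image of
    the real one. *)
Lemma ereal_bound_eq n :
  ((moment_const R h * 8 ^+ m * n%:R *
     (Ex (fun w => `|f (zeta 1 w)| ^+ p) + Hu n ^+ p + Ha n ^+ m + Hb n ^+ m))%:E =
   (moment_const R h * 8 ^+ m)%:E *
      (n%:R%:E * 'E_P[(fun w => (`|f (zeta 1 w)| ^+ p)%R)]
       + n%:R%:E *
         (\sum_(1 <= k < n.+1)
            ((k%:R `^ (1 + 1 / p%:R))^-1)%R%:E *
            'N[P]_(p%:R%:E) [(fun w => (E0 (S k) w)%:E)]) ^+ p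
       + n%:R%:E *
         (\sum_(1 <= k < n.+1)
            ((k%:R `^ (1 + 2 / p%:R))^-1)%R%:E *
            'N[P]_(m%:R%:E)
              [(fun w => (E0 (fun w => (S k w ^+ 2)%R) w)%:E - 'E_P[(fun w => (S k w ^+ 2)%R)])]) ^+ m
       + n%:R%:E *
         (\sum_(1 <= k < n.+1)
            ((k%:R `^ (1 + 2 / p%:R))^-1)%R%:E * 'E_P[(fun w => (S k w ^+ 2)%R)]) ^+ m))%E.
Proof.
have eE k : 'E_P[(fun w => (S k w ^+ 2)%R)]%E = (Ex (fun w => (S k w ^+ 2)%R))%:E.
  by rewrite unlock Ex_EFin.
have ef : 'E_P[(fun w => (`|f (zeta 1 w)| ^+ p)%R)]%E = (Ex (fun w => `|f (zeta 1 w)| ^+ p))%:E.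
  by rewrite unlock Ex_EFin//; case: (f_inL 1).
have s1 : (\sum_(1 <= k < n.+1) ((k%:R `^ (1 + 1 / p%:R))^-1)%R%:E *
    'N[P]_(p%:R%:E) [(fun w => (E0 (S k) w)%:E)] = (Hu n)%:E)%E.
  rewrite -sumEFin; apply: eq_bigr => k _.
  by rewrite (LnormE _ (condexp_S_inL k)).
have s2 : (\sum_(1 <= k < n.+1) ((k%:R `^ (1 + 2 / p%:R))^-1)%R%:E * 'N[P]_(m%:R%:E)
    [(fun w => (E0 (fun w => (S k w ^+ 2)%R) w)%:E - 'E_P[(fun w => (S k w ^+ 2)%R)])] = (Ha n)%:E)%E.
  rewrite -sumEFin; apply: eq_bigr => k _; rewrite EFinM eE.
  have L := inLD (condexp_S2_inL k) (inLN (@inL_bounded _ T R P m `|Ex (fun w => (S k w ^+ 2)%R)|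
    (cst (Ex (fun w => (S k w ^+ 2)%R))) (@measurable_cst _ _ _ _ _ _) (fun=> lexx _))).
  by rewrite -(LnormE _ L).
have s3 : (\sum_(1 <= k < n.+1) ((k%:R `^ (1 + 2 / p%:R))^-1)%R%:E * 'E_P[(fun w => (S k w ^+ 2)%R)]
    = (Hb n)%:E)%E.
  by rewrite -sumEFin; apply: eq_bigr => k _; rewrite eE.
rewrite s1 s2 s3 ef -!EFin_expe -!EFinM.
congr EFin.
by rewrite -!mulrDr -[LHS]mulrA.
Qed.

End reversible_moment_bound.

Theorem corollary29 (R : realType) (p : nat) (p_ge4 : (4 <= p)%N)
    (p_even : ~~ odd p) :
  exists C : R,
  forall (d dE : measure_display) (T : measurableType d)
    (E : measurableType dE) (P : probability T R)
    (zeta : int -> {RV P >-> E}) (Q : R.-pker E ~> E) (f : E -> R),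
  stationary zeta ->
  markov_property zeta ->
  transition_kernel zeta Q ->
  let pi := distribution P (zeta 0) in
  reversible pi Q ->
  measurable_fun setT f ->
  (\int[pi]_x (`|f x| ^+ p)%:E < +oo)%E ->
  (\int[pi]_x (f x)%:E = 0)%E ->
  let S := partial_sum zeta f in
  let S2 := fun k w => S k w ^+ 2 in
  let E0 := condexp P (past zeta 0) in
  forall n : nat, (0 < n)%N ->
  ('E_P[(fun w => \big[Num.max/0%R]_(1 <= k < n.+1) (`|S k w| ^+ p)%R)]
   <= C%:E *
      (n%:R%:E * 'E_P[(fun w => (`|f (zeta 1 w)| ^+ p)%R)]
       + n%:R%:E *
         (\sum_(1 <= k < n.+1)
            ((k%:R `^ (1 + 1 / p%:R))^-1)%R%:E *
            'N[P]_(p%:R%:E) [(fun w => (E0 (S k) w)%:E)]) ^+ p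
       + n%:R%:E *
         (\sum_(1 <= k < n.+1)
            ((k%:R `^ (1 + 2 / p%:R))^-1)%R%:E *
            'N[P]_((p./2)%:R%:E)
              [(fun w => (E0 (S2 k) w)%:E - 'E_P[S2 k])]) ^+ p./2
       + n%:R%:E *
         (\sum_(1 <= k < n.+1)
            ((k%:R `^ (1 + 2 / p%:R))^-1)%R%:E * 'E_P[S2 k]) ^+ p./2))%E.
Proof.
have [h ph hh] : exists2 h, p = h.*2.+4 & p./2 = h.+2.
  (* Writing p = 2h + 4 builds both evenness and [4 <= p] into the exponent, with p/2 = h + 2. *)
  by exists (p./2 - 2)%N; lia.
rewrite hh {p_ge4 p_even}; subst p.
exists (moment_const R h * 8 ^+ h.+2) => d dE T E P zeta Q f st mk tk pi rv mf ff _ S S2 E0 n n0.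
have e := ereal_bound_eq st mf ff n.
rewrite -e.
exact: (expectation_max_bound st mk tk rv mf ff).
Qed.
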